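(* Let $d\ge 1$ be an integer, $A>0$, let $\beta,\delta\in\mathbb N^*$ be integer smoothness parameters and let $R>0$ satisfy $R^2>d$. Then there exists a constant $c=c_{A,d,\delta,\beta,R}>0$, depending only on $A,d,\delta,\beta,R$, such that for every sample size $n\ge 1$ and every privacy level $\alpha\in(0,A]$ with $n\alpha^2\ge 1$, $$\rho_n(\mathcal W^{\beta}(R),\mathcal W^{\delta}(1),\mathcal Q_\alpha)\ \ge\ c\,\max\left\{(n\alpha^2)^{-\frac{\beta+\delta}{2\beta+2d}},\,(n\alpha^2)^{-1/2}\right\}.$$
   Context: $\mathbb N^*$ denotes the positive integers. Fourier basis: for $t\in[0,1]$, $\varphi_1(t)=1$, and for $j\in\mathbb N^*$, $\varphi_{2j}(t)=\sqrt2\cos(2\pi jt)$, $\varphi_{2j+1}(t)=\sqrt2\sin(2\pi jt)$. For $\mathbf j=(j_1,\dots,j_d)\in(\mathbb N^* )^d$ and $x\in[0,1]^d$, $\varphi_{\mathbf j}(x)=\prod_{m=1}^d\varphi_{j_m}(x_m)$; this is an orthonormal basis of $L_2([0,1]^d)$. Put $\theta_{\mathbf j}(f)=\int_{[0,1]^d}f\varphi_{\mathbf j}$. Isotropic Sobolev ball, for $\beta,R>0$: $\mathcal W^\beta(R)=\{f\in L_2([0,1]^d):\ \sum_{\mathbf j\in(\mathbb N^* )^d}(j_1^{2\beta}+\dots+j_d^{2\beta})\,\theta_{\mathbf j}^2(f)\le R^2\}$. Adversarial loss: for a class $\mathcal G$ of real functions on $[0,1]^d$, $d_{\mathcal G}(f_1,f_2)=\sup_{g\in\mathcal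 G}\int_{[0,1]^d}(f_1-f_2)g$. Local differential privacy: $X_1,\dots,X_n$ are i.i.d. with density $f$ on $[0,1]^d$ (w.r.t. Lebesgue measure). A privacy mechanism $Q=(Q_1,\dots,Q_n)$ is a sequence of Markov kernels producing successively $Z_i\sim Q_i(\cdot\mid X_i=x_i,Z_1=z_1,\dots,Z_{i-1}=z_{i-1})$ in a measurable space $(\mathcal Z,\mathcal B)$. It is $\alpha$-LDP if for all $1\le i\le n$, all $z_1,\dots,z_{i-1}\in\mathcal Z$ and all $x_i,x_i'\in[0,1]^d$, $$\sup_{B\in\mathcal B}\frac{Q_i(B\mid X_i=x_i,Z_1=z_1,\dots,Z_{i-1}=z_{i-1})}{Q_i(B\mid X_i=x_i',Z_1=z_1,\dots,Z_{i-1}=z_{i-1})}\le e^\alpha.$$ $\mathcal Q_\alpha$ is the set of all $\alpha$-LDP mechanisms (interactive ones included). Minimax rate: $\rho_n(\mathcal F,\mathcal G,\mathcal Q_\alpha)=\inf_{Q\in\mathcal Q_\alpha}\inf_{\tilde f}\sup_{f\in\mathcal F}\mathbb E[d_{\mathcal G}(\tilde f,f)]$, where the supremum is over the probability densities $f$ belonging to $\mathcal F$, the infimum over $\tilde f$ is over all estimators of $f$ based on the privatized data $(Z_1,\dots,Z_n)$ obtained from $Q$, and the expectation is taken when the $X_i$ have density $f$ and the $Z_i$ are generated by $Q$. *)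

(* Defs.v *)
From HB Require Import structures.
From mathcomp Require Import all_boot all_order all_algebra.
From mathcomp Require Import all_classical all_reals all_analysis.
From mathcomp Require Import measurable_realfun.

Set Implicit Arguments.
Unset Strict Implicit.
Unset Printing Implicit Defensive.

Import Order.TTheory GRing.Theory Num.Theory.
Import numFieldNormedType.Exports.

Local Open Scope classical_set_scope.
Local Open Scope ring_scope.

Notation euclid R d := (d.-tuple (measurableTypeR R)).

Section lebesgue_cons.
Context (R : realType) (d : nat).
Variable m : {sigma_finite_measure set (euclid R d) -> \bar R}.

Let cons_pair (p : (measurableTypeR R * euclid R d)%type) : euclid R d.+1 :=
  [tuple of p.1 :: p.2].

Let measurable_cons_pair : measurable_fun [set: _] cons_pair.
Proof. exact: measurable_cons. Qed.

Definition lebesgue_cons : set (euclid R d.+1) -> \bar R :=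
  pushforward (lebesgue_measure \x m)%E cons_pair.

Let lebesgue_cons0 : lebesgue_cons set0 = 0%E.
Proof. by rewrite /lebesgue_cons /pushforward preimage_set0 measure0. Qed.

Let lebesgue_cons_ge0 A : (0 <= lebesgue_cons A)%E.
Proof. exact: measure_ge0. Qed.

Let lebesgue_cons_sigma_additive : semi_sigma_additive lebesgue_cons.
Proof.
move=> F mF tF mUF; rewrite /lebesgue_cons /pushforward preimage_bigcup.
apply: measure_semi_sigma_additive.
- by move=> n; rewrite -[X in measurable X]setTI; exact: measurable_cons_pair.
- apply/trivIsetP => /= i j _ _ ij; rewrite -preimage_setI.
  by move/trivIsetP : tF => /(_ _ _ _ _ ij) ->//; rewrite preimage_set0.
- by rewrite -preimage_bigcup -[X in measurable X]setTI;
     exact: measurable_cons_pair.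
Qed.

HB.instance Definition _ := isMeasure.Build _ _ _ lebesgue_cons
  lebesgue_cons0 lebesgue_cons_ge0 lebesgue_cons_sigma_additive.

Let lebesgue_cons_sigma_finite : sigma_finite [set: _] lebesgue_cons.
Proof.
have /sigma_finiteP[F [FT ndF Foo]] := sigma_finiteT (@lebesgue_measure R).
have /sigma_finiteP[G [GT ndG Goo]] := sigma_finiteT m.
pose box n : set (euclid R d.+1) :=
  [set x | F n (thead x) /\ G n [tuple of behead x]].
exists box.
  apply/seteqP; split => // x _.
  have [i _ Fi] : (\bigcup_i F i) (thead x) by rewrite -FT.
  have [j _ Gj] : (\bigcup_i G i) [tuple of behead x] by rewrite -GT.
  exists (maxn i j) => //; split.
    by move: Fi; exact/subsetPset/ndF/leq_maxl.
  by move: Gj; exact/subsetPset/ndG/leq_maxr.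
move=> n; have [mFn Fn] := Foo n; have [mGn Gn] := Goo n; split.
  rewrite (_ : box n = (fun x : euclid R d.+1 => thead x) @^-1` F n `&`
      (fun x : euclid R d.+1 => [tuple of behead x]) @^-1` G n) //.
  apply: measurableI; rewrite -[X in measurable X]setTI.
    exact: (measurable_tnth ord0 measurableT mFn).
  exact: (@measurable_behead _ (measurableTypeR R) d measurableT _ mGn).
rewrite /lebesgue_cons /pushforward (_ : _ @^-1` _ = F n `*` G n).
  by rewrite product_measure1E// lte_mul_pinfty// ge0_fin_numE.
apply/seteqP; split => -[a b] /=; rewrite /box /= theadE.
  by move=> [Fa Gb]; split => //; congr (G n): Gb; exact: val_inj.
by move=> [Fa Gb]; split => //; congr (G n): Gb; exact: val_inj.
Qed.

HB.instance Definition _ := Measure_isSigmaFinite.Build _ _ _ lebesgue_cons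
  lebesgue_cons_sigma_finite.

End lebesgue_cons.

(* Lebesgue measure on R^d, as the d-fold product of the one-dimensional one. *)
Fixpoint lebesgue (R : realType) (d : nat) :
    {sigma_finite_measure set (euclid R d) -> \bar R} :=
  match d with
  | 0 => \d_[tuple]
  | d'.+1 => lebesgue_cons (lebesgue R d')
  end.

Section sobolev.
Context (R : realType) (d : nat).
Implicit Types (f g : euclid R d -> R) (G : set (euclid R d -> R)).

(* Functions on [0,1]^d are represented by functions on R^d; everything below
   only depends on their values on the cube. *)
Definition cube : set (euclid R d) :=
  [set x | forall i : 'I_d, 0 <= tnth x i <= 1].

Lemma measurable_cube : measurable cube.
Proof.
rewrite (_ : cube = \bigcap_(i in [set: 'I_d]) ((@tnth d _)^~ i @^-1` `[0, 1])).
  apply: fin_bigcap_measurable; [exact: finite_finset|move=> i _].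
  rewrite -[X in measurable X]setTI; exact: measurable_tnth.
by apply/seteqP; split => x cx i; have := cx i; rewrite /= in_itv//=; apply.
Qed.

(* Indices start at 1: the value at j = 0 is never used. *)
Definition fourier1 (j : nat) (t : R) : R :=
  if j == 1%N then 1
  else if odd j then Num.sqrt 2 * sin (2 * pi * j./2%:R * t)
  else Num.sqrt 2 * cos (2 * pi * j./2%:R * t).

Definition fourier (j : d.-tuple nat) (x : euclid R d) : R :=
  \prod_(m < d) fourier1 (tnth j m) (tnth x m).

Definition fourier_coef f (j : d.-tuple nat) : R :=
  \int[lebesgue R d]_(x in cube) (f x * fourier j x).

Definition square_integrable f :=
  measurable_fun cube f /\
  (\int[lebesgue R d]_(x in cube) (f x ^+ 2)%:E < +oo)%E.

Definition multi_index : set (d.-tuple nat) :=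
  [set j | forall m : 'I_d, (0 < tnth j m)%N].

Definition sobolev_ball (beta r : R) : set (euclid R d -> R) :=
  [set f | square_integrable f /\
    (\esum_(j in multi_index)
       ((\sum_(m < d) (tnth j m)%:R `^ (2 * beta)) * fourier_coef f j ^+ 2)%:E
     <= (r ^+ 2)%:E)%E].

Definition adversarial_loss G f1 f2 : \bar R :=
  ereal_sup [set \int[lebesgue R d]_(x in cube) ((f1 x - f2 x) * g x)%:E
            | g in G]%E.

End sobolev.
Arguments cube {R d}.

Record density (R : realType) (d : nat) := Density {
  pdf :> euclid R d -> R;
  measurable_pdf : measurable_fun cube pdf;
  pdf_ge0 : forall x, cube x -> 0 <= pdf x;
  integral_pdf : (\int[lebesgue R d]_(x in cube) (pdf x)%:E = 1)%E }.

Section density_prob.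
Context (R : realType) (d : nat) (f : density R d).

Definition density_prob (A : set (euclid R d)) : \bar R :=
  (\int[lebesgue R d]_(x in cube `&` A) (f x)%:E)%E.

Let density_prob0 : density_prob set0 = 0%E.
Proof. by rewrite /density_prob setI0 integral_set0. Qed.

Let density_prob_ge0 A : (0 <= density_prob A)%E.
Proof. by apply: integral_ge0 => x [cx _]; rewrite lee_fin pdf_ge0. Qed.

Let density_prob_sigma_additive : semi_sigma_additive density_prob.
Proof.
move=> F mF tF mUF; rewrite /density_prob setI_bigcupr ge0_integral_bigcup//.
- apply: is_cvg_nneseries => n _ _; exact: density_prob_ge0.
- by move=> n; apply: measurableI => //; exact: measurable_cube.
- apply/measurable_EFinP; apply: measurable_funS (measurable_pdf f).
    exact: measurable_cube.
  by rewrite -setI_bigcupr; exact: subIsetl.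
- by move=> x; rewrite -setI_bigcupr => -[cx _]; rewrite lee_fin pdf_ge0.
- exact: trivIset_setIl.
Qed.

HB.instance Definition _ := isMeasure.Build _ _ _ density_prob
  density_prob0 density_prob_ge0 density_prob_sigma_additive.

Let density_prob_setT : density_prob [set: _] = 1%E.
Proof. by rewrite /density_prob setIT integral_pdf. Qed.

HB.instance Definition _ := Measure_isProbability.Build _ _ _ density_prob
  density_prob_setT.

End density_prob.

(* The kernel Q i gives the law of the i-th output (counting from 0) from its
   input x and from the i previous outputs.  Kernels are defined on R^d, but the
   inputs lie almost surely in the cube, so only x in the cube matters. *)
Definition mechanism (R : realType) (d n : nat) (dZ : measure_display)
    (Z : measurableType dZ) : Type :=
  forall i : 'I_n, R.-pker (euclid R d * i.-tuple Z) ~> Z.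

(* In \bar R, a / 0 = +oo for a > 0 and 0 / 0 = 0: sets that are null for both
   inputs impose no constraint. *)
Definition ldp (R : realType) (d n : nat) (dZ : measure_display)
    (Z : measurableType dZ) (alpha : R) (Q : mechanism R d n Z) : Prop :=
  forall (i : 'I_n) (z : i.-tuple Z) (x x' : euclid R d), cube x -> cube x' ->
    (ereal_sup [set Q i (x, z) B / Q i (x', z) B | B in measurable]
     <= (expR alpha)%:E)%E.

Lemma measurable_rcons (d1 d2 : measure_display) (T1 : measurableType d1)
    (T2 : measurableType d2) (k : nat) (g : T1 -> k.-tuple T2) (f : T1 -> T2) :
  measurable_fun [set: T1] g -> measurable_fun [set: T1] f ->
  measurable_fun [set: T1] (fun x => rcons_tuple (g x) (f x)).
Proof.
move=> mg mf; apply/measurable_fun_tnthP => i.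
have [ik|ki] := ltnP i k.
  rewrite (_ : _ \o _ = fun x => tnth (g x) (Ordinal ik)).
    by move/measurable_fun_tnthP : mg; exact.
  apply/funext => x /=; rewrite (tnth_nth (f x)) (tnth_nth (f x)) /=.
  by rewrite nth_rcons size_tuple ik.
rewrite (_ : _ \o _ = f) //; apply/funext => x /=.
have ik : i = k :> nat by apply/eqP; rewrite eqn_leq ki -ltnS ltn_ord.
by rewrite (tnth_nth (f x)) /= nth_rcons size_tuple ik ltnn eqxx.
Qed.

Lemma measurable_map_snd (d1 d2 : measure_display) (T1 : measurableType d1)
    (T2 : measurableType d2) (k : nat) :
  measurable_fun [set: k.-tuple (T1 * T2)%type] (map_tuple (@snd T1 T2)).
Proof.
apply/measurable_fun_tnthP => i.
rewrite (_ : _ \o _ = fun w => (tnth w i).2).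
  by apply: measurableT_comp => //; exact: measurable_tnth.
by apply/funext => w /=; rewrite tnth_map.
Qed.

Section law_rcons.
Context (R : realType) (d k : nat) (dZ : measure_display)
  (Z : measurableType dZ).
Local Notation XZ := (euclid R d * Z)%type.
Variables (P : probability (k.-tuple XZ) R) (f : density R d)
  (q : R.-pker (euclid R d * k.-tuple Z) ~> Z).

Local Notation WX := (k.-tuple XZ * euclid R d)%type.

Definition kernel_past (wx : WX) : {measure set Z -> \bar R} := q (wx.2, map_tuple snd wx.1).

Let measurable_kernel_past U : measurable U -> measurable_fun [set: WX] (kernel_past ^~ U).
Proof.
move=> mU; apply: (measurableT_comp (measurable_kernel q U mU)).
apply/measurable_fun_pairP; split => /=; first exact: measurable_snd.
exact: (measurableT_comp (@measurable_map_snd _ _ _ _ k)).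
Qed.

HB.instance Definition _ := isKernel.Build _ _ _ _ _ kernel_past measurable_kernel_past.

Let kernel_past_setT wx : kernel_past wx [set: Z] = 1%E.
Proof. exact: prob_kernel. Qed.

HB.instance Definition _ := Kernel_isProbability.Build _ _ _ _ _ kernel_past kernel_past_setT.

(* If w = ((X_1, Z_1), ..., (X_k, Z_k)) has law P, and X_{k+1} is independent of w
   with density f, and Z_{k+1} ~ q(. | X_{k+1}, Z_1, ..., Z_k), then this is the law
   of w followed by (X_{k+1}, Z_{k+1}). *)
Definition law_rcons (A : set (k.+1.-tuple XZ)) : \bar R :=
  (\int[P \x density_prob f]_wx
     q (wx.2, map_tuple snd wx.1)
       [set z | A (rcons_tuple wx.1 (wx.2, z))])%E.

Let section (A : set (k.+1.-tuple XZ)) (wx : WX) : set Z :=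
  [set z | A (rcons_tuple wx.1 (wx.2, z))].

Let sectionE A wx : section A wx = xsection
  ((fun p : WX * Z => rcons_tuple p.1.1 (p.1.2, p.2)) @^-1` A) wx.
Proof. by rewrite xsectionE. Qed.

Let measurable_preimage A : measurable A ->
  measurable ((fun p : WX * Z => rcons_tuple p.1.1 (p.1.2, p.2)) @^-1` A).
Proof.
move=> mA; rewrite -[X in measurable X]setTI.
apply: (@measurable_rcons _ _ _ _ k (fun p : WX * Z => p.1.1)
  (fun p : WX * Z => (p.1.2, p.2))) => //.
  exact: (measurableT_comp measurable_fst measurable_fst).
apply/measurable_fun_pairP; split; last exact: measurable_snd.
exact: (measurableT_comp measurable_snd measurable_fst).
Qed.

Let measurable_section A wx : measurable A -> measurable (section A wx).
Proof.
by move=> mA; rewrite sectionE; apply: measurable_xsection; exact: measurable_preimage.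
Qed.

Let measurable_q_section A : measurable A ->
  measurable_fun [set: WX] (fun wx => kernel_past wx (section A wx)).
Proof.
move=> mA; under eq_fun do rewrite sectionE.
apply: measurable_fun_xsection_finite_kernel; rewrite inE.
exact: measurable_preimage.
Qed.

Let law_rcons0 : law_rcons set0 = 0%E.
Proof. by apply: integral0_eq => wx _; exact: measure0. Qed.

Let law_rcons_ge0 A : (0 <= law_rcons A)%E.
Proof. by apply: integral_ge0. Qed.

Let law_rcons_sigma_additive : semi_sigma_additive law_rcons.
Proof.
move=> F mF tF mUF.
rewrite [X in _ --> X](_ : _ = \sum_(n <oo) law_rcons (F n))%E.
  by apply/cvg_closeP; split; [exact: is_cvg_nneseries|rewrite closeE].
rewrite -integral_nneseries//; last by move=> n; exact: measurable_q_section.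
apply: eq_integral => wx _; apply/esym/cvg_lim => //=.
apply: (@measure_sigma_additive _ _ _ (kernel_past wx) (fun n => section (F n) wx)).
  by move=> n; exact: measurable_section.
apply/trivIsetP => i j _ _ ij; rewrite -subset0 => z [Fi Fj].
move: tF => /trivIsetP/(_ i j I I ij) F0.
have : (F i `&` F j) (rcons_tuple wx.1 (wx.2, z)) by split.
by rewrite F0.
Qed.

HB.instance Definition _ := isMeasure.Build _ _ _ law_rcons
  law_rcons0 law_rcons_ge0 law_rcons_sigma_additive.

Let law_rcons_setT : law_rcons [set: _] = 1%E.
Proof.
rewrite /law_rcons (eq_integral (cst 1%E)).
  rewrite integral_cst// mul1e.
  exact: (@probability_setT _ _ _ (P \x density_prob f)%E).
by move=> wx _; exact: kernel_past_setT.
Qed.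

HB.instance Definition _ := Measure_isProbability.Build _ _ _ law_rcons
  law_rcons_setT.

End law_rcons.

Section risk.
Context (R : realType) (d n : nat) (dZ : measure_display)
  (Z : measurableType dZ).
Implicit Types (Q : mechanism R d n Z) (G : set (euclid R d -> R)).

(* Law of ((X_1, Z_1), ..., (X_k, Z_k)). *)
Fixpoint joint_law Q (f : density R d) (k : nat) :
    (k <= n)%N -> probability (k.-tuple (euclid R d * Z)%type) R :=
  match k with
  | 0 => fun _ => \d_[tuple]
  | k'.+1 => fun kn => law_rcons (joint_law Q f (ltnW kn)) f (Q (Ordinal kn))
  end.

(* The integrability condition says that the integrals defining the loss exist;
   it holds when ft z is square-integrable and G is a subset of L_2. *)
Definition estimator G (ft : n.-tuple Z -> euclid R d -> R) : Prop :=
  measurable_fun [set zx : n.-tuple Z * euclid R d | cube zx.2]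
    (fun zx => ft zx.1 zx.2) /\
  forall z g, G g ->
    (lebesgue R d).-integrable cube (fun x => (ft z x * g x)%:E).

Definition risk G Q (ft : n.-tuple Z -> euclid R d -> R) (f : density R d) :
    \bar R :=
  (\int[joint_law Q f (leqnn n)]_w
     adversarial_loss G (ft (map_tuple snd w)) f)%E.

End risk.

(* The infimum over mechanisms also ranges over the output space Z. *)
Definition minimax_rate (R : realType) (d n : nat)
    (F G : set (euclid R d -> R)) (alpha : R) : \bar R :=
  ereal_inf [set s | exists (dZ : measure_display) (Z : measurableType dZ)
      (Q : mechanism R d n Z), ldp alpha Q /\
    s = ereal_inf [set ereal_sup [set risk G Q ft f | f in [set f : density R d | F f]]
                  | ft in estimator (Z := Z) G]].

(* Main.v *)
Require Import Defs.
From mathcomp Require Import all_boot all_order all_algebra.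
From mathcomp Require Import all_classical all_reals all_analysis.
From mathcomp Require Import measurable_realfun ring lra.

Set Implicit Arguments.
Unset Strict Implicit.
Unset Printing Implicit Defensive.

Import Order.TTheory GRing.Theory Num.Theory.
Import numFieldNormedType.Exports.

Local Open Scope classical_set_scope.
Local Open Scope ring_scope.

(** The minimax risk is bounded below over a hypercube of densities,
    the constant density on the cube perturbed by localised bumps,

      [f_e = 1 + gam * \sum_K (-1)^(e K) (Phi_K - N^-d)],

    one sign [e K] for each node [K] of the grid with [N^d] points.  Three facts
    make the argument work.

    The bumps.  [Phi_K] is a product of translates of the one-dimensional Fejer
    kernel, normalised to have mass [1/N].  The Fejer kernel is nonnegative, its
    [N] translates by multiples of [1/N] sum to one, and it is a trigonometric
    polynomial of degree less than [N].  Hence every combination of the [Phi_K]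
    with coefficients between -1 and 1 is bounded by one in absolute value, has
    Fourier coefficients supported on indices at most [2N - 1], and has a
    squared L2 norm at most one, which by orthonormality is the sum of its
    squared coefficients.  Its squared Sobolev norm is therefore at most
    [d (2N)^(2 s)], with no derivative to compute ([sobolev_comb]).  The
    constant density accounts for [d < r^2] in the squared Sobolev norm of [f_e],
    so [f_e] is a density in the ball of smoothness [beta] when [gam] is a small
    multiple of [N^-beta], and [N^-delta] times such a combination is, up to a constant, a
    member of the dual ball of smoothness [delta].

    Privacy.  Flipping one sign changes the density by at most [4 gam N^-d] in
    L1 norm.  Locally private outputs contract this: for one output, a function
    integrated against the outputs of two inputs varies by a relative factor
    [exp alpha - 1] only, so the chi-square divergence of the two output laws is
    at most the square of [(exp alpha - 1) * 4 gam N^-d] ([channel_chi_square]).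
    A divergence bound is used here in its dual form,

      [(\int phi dP')^2 <= (1 + chi2) * \int phi^2 dP  for all test functions],

    which involves no density of the output laws and composes along the
    successive outputs of an interactive mechanism, conditionally on the past
    ([transcript_chi_square]).  When [n alpha^2 gam^2 N^(-2d)] is small the two
    laws of the whole transcript cannot be told apart ([transcript_overlap]).

    Separation.  Taking [\sum_K s_K Phi_K] with the best signs as dual function,
    the loss of an estimator at [f_e] dominates [N^-delta] times the sum over [K]
    of the distances between [\int ft Phi_K] and [\int f_e Phi_K].  The second
    integral moves by an amount of order [gam N^-d] when the sign [e K] is
    flipped.  Averaging over all signs and pairing [e] with its flips gives a risk
    of order [gam N^-delta] at some vertex ([private_assouad]).

    It remains to choose [N] and [gam], subject to [gam <= N^-beta] and
    [gam <= N^d (n alpha^2)^(-1/2)] up to constants ([minimax_rate_ge]).  The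
    choice [N ~ (n alpha^2)^(1 / (2 beta + 2 d))], [gam ~ N^-beta] gives the first
    rate, and [N = 3], [gam ~ (n alpha^2)^(-1/2)] gives the second. *)

(** * Integrals against mixtures of measures *)

Section mixture.
Context d1 d2 (Y : measurableType d1) (X : measurableType d2) (R : realType).
Variables (nu : {measure set Y -> \bar R}) (k : Y -> {measure set X -> \bar R})
  (mu : {measure set X -> \bar R}).
Hypothesis mk : forall U, measurable U -> measurable_fun [set: Y] (k ^~ U).
Hypothesis muE : forall U, measurable U -> mu U = (\int[nu]_y k y U)%E.

Import HBNNSimple.
Local Open Scope ereal_scope.

Let sintegral_mixture (h : {nnsfun X >-> R}) :
  sintegral mu h = \int[nu]_y sintegral (k y) h.
Proof.
under eq_integral do rewrite sintegralE.
rewrite ge0_integral_fsum//; last 2 first.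
- by move=> r; apply: measurable_funeM; exact: mk.
- by move=> r y _; exact: nnsfun_mulemu_ge0.
rewrite sintegralE; apply: eq_fsbigr => r _.
have [->|r0] := eqVneq (h @^-1` [set r]) set0.
  rewrite measure0 mule0; under eq_integral do rewrite measure0 mule0.
  by rewrite integral0.
have [z hz] : exists z, h z = r by move/set0P : r0 => [z]; exists z.
rewrite ge0_integralZl//; first by rewrite muE.
- exact: mk.
- by rewrite lee_fin -hz.
Qed.

(** The common source of the integration formulas below: both a law with a
    density and the law of the data after one more output are mixtures. *)
Lemma ge0_integral_mixture (F : X -> \bar R) :
  measurable_fun [set: X] F -> (forall x, 0 <= F x) ->
  \int[mu]_x F x = \int[nu]_y \int[k y]_x F x.
Proof.
move=> mF F0; pose g := nnsfun_approx measurableT mF.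
have mg n : measurable_fun [set: X] (EFin \o g n) by exact/measurable_EFinP.
have g0 n x : 0 <= (EFin \o g n) x by rewrite lee_fin.
have ndg x : {homo (fun n => (EFin \o g n) x) : n m / (n <= m)%O >-> n <= m}.
  by move=> *; exact/lefP/nd_nnsfun_approx.
have Fg (m : {measure set X -> \bar R}) :
    \int[m]_x F x = limn (fun n => \int[m]_x (EFin \o g n) x).
  rewrite -monotone_convergence//; apply: eq_integral => x _.
  by apply/esym/cvg_lim => //; exact: cvg_nnsfun_approx.
rewrite Fg (eq_integral _ _ (fun y _ => Fg (k y))).
rewrite monotone_convergence//.
- apply: congr_lim; apply/funext => n.
  rewrite integralT_nnsfun sintegral_mixture; apply: eq_integral => y _.
  by rewrite integralT_nnsfun.
- by move=> n; exact: measurable_fun_integral_kernel.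
- by move=> n y _; exact: integral_ge0.
- by move=> y _ m n mn; apply: ge0_le_integral => // t _; exact: ndg.
Qed.

End mixture.

(** * Means of bounded measurable functions *)

Section bounded_measurable.
Context d (T : measurableType d) (R : realType).
Implicit Types (D : set T) (f g : T -> R).

(** Every function to be averaged below belongs to this class, which is stable under
    the ring operations and integrable for all finite measures. *)
Definition bounded_mfun D f :=
  measurable_fun D f /\ exists M : R, forall x, D x -> `|f x| <= M.

Lemma bounded_mfun_integrable (mu : {measure set T -> \bar R}) D f :
  measurable D -> (mu D < +oo)%E -> bounded_mfun D f ->
  mu.-integrable D (EFin \o f).
Proof.
move=> mD muD [mf [M fM]]; apply: measurable_bounded_integrable => //.
exists M; split; first exact: num_real.
by move=> N MN x Dx; exact: le_trans (fM _ Dx) (ltW MN).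
Qed.

Lemma bounded_mfun_cst D (c : R) : bounded_mfun D (fun=> c).
Proof. by split; [exact: measurable_cst|exists `|c|]. Qed.

Lemma bounded_mfunD D f g :
  bounded_mfun D f -> bounded_mfun D g -> bounded_mfun D (fun x => f x + g x).
Proof.
move=> [mf [M fM]] [mg [N gN]]; split; first exact: measurable_funD.
by exists (M + N) => x Dx; rewrite (le_trans (ler_normD _ _))// lerD ?fM ?gN.
Qed.

Lemma bounded_mfunB D f g :
  bounded_mfun D f -> bounded_mfun D g -> bounded_mfun D (fun x => f x - g x).
Proof.
move=> [mf [M fM]] [mg [N gN]]; split; first exact: measurable_funB.
by exists (M + N) => x Dx; rewrite (le_trans (ler_normB _ _))// lerD ?fM ?gN.
Qed.

Lemma bounded_mfunM D f g :
  bounded_mfun D f -> bounded_mfun D g -> bounded_mfun D (fun x => f x * g x).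
Proof.
move=> [mf [M fM]] [mg [N gN]]; split; first exact: measurable_funM.
by exists (M * N) => x Dx; rewrite normrM ler_pM ?fM ?gN.
Qed.

Lemma bounded_mfunX D f n :
  bounded_mfun D f -> bounded_mfun D (fun x => f x ^+ n).
Proof.
move=> bf; elim: n => [|n ih]; first exact: bounded_mfun_cst.
by under [X in bounded_mfun _ X]eq_fun do rewrite exprS; exact: bounded_mfunM.
Qed.

Lemma bounded_mfun_norm D f :
  bounded_mfun D f -> bounded_mfun D (fun x => `|f x|).
Proof.
move=> [mf [M fM]]; split; first exact: measurableT_comp.
by exists M => x Dx; rewrite normr_id fM.
Qed.

Lemma bounded_mfunS D E f : measurable E -> D `<=` E ->
  bounded_mfun E f -> bounded_mfun D f.
Proof.
move=> mE DE [mf [M fM]]; split; first exact: measurable_funS mf.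
by exists M => x /DE; exact: fM.
Qed.

Lemma bounded_mfun_sum (I : finType) D (F : I -> T -> R) :
  (forall i, bounded_mfun D (F i)) -> bounded_mfun D (fun x => \sum_i F i x).
Proof.
move=> bF; elim: (index_enum I) => [|i r ih].
  by under [X in bounded_mfun _ X]eq_fun do rewrite big_nil; exact: bounded_mfun_cst.
by under [X in bounded_mfun _ X]eq_fun do rewrite big_cons; exact: bounded_mfunD.
Qed.

End bounded_measurable.

Section mean.
Context d (T : measurableType d) (R : realType) (mu : {measure set T -> \bar R})
  (D : set T).
Hypotheses (mD : measurable D) (muD : mu D = 1%E).
Implicit Types f g : T -> R.

Let muDoo : (mu D < +oo)%E. Proof. by rewrite muD ltry. Qed.
Let mint f : bounded_mfun D f -> mu.-integrable D (EFin \o f).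
Proof. exact: bounded_mfun_integrable. Qed.

Lemma mean_cst c : \int[mu]_(x in D) c = c.
Proof. by rewrite Rintegral_cst// muD mulr1. Qed.

Lemma meanB f g : bounded_mfun D f -> bounded_mfun D g ->
  \int[mu]_(x in D) (f x - g x) =
  \int[mu]_(x in D) f x - \int[mu]_(x in D) g x.
Proof. by move=> bf bg; apply: RintegralB => //; exact: mint. Qed.

Lemma meanD f g : bounded_mfun D f -> bounded_mfun D g ->
  \int[mu]_(x in D) (f x + g x) =
  \int[mu]_(x in D) f x + \int[mu]_(x in D) g x.
Proof. by move=> bf bg; apply: RintegralD => //; exact: mint. Qed.

Lemma meanZ c f : bounded_mfun D f ->
  \int[mu]_(x in D) (c * f x) = c * \int[mu]_(x in D) f x.
Proof. by move=> bf; apply: RintegralZl => //; exact: mint. Qed.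

Lemma le_mean f g : bounded_mfun D f -> bounded_mfun D g ->
  (forall x, D x -> f x <= g x) ->
  \int[mu]_(x in D) f x <= \int[mu]_(x in D) g x.
Proof. by move=> bf bg fg; apply: le_Rintegral => //; exact: mint. Qed.

Lemma mean_norm f : bounded_mfun D f ->
  `|\int[mu]_(x in D) f x| <= \int[mu]_(x in D) `|f x|.
Proof. by move=> bf; apply: le_normr_Rintegral => //; exact: mint. Qed.

Lemma mean_norm_le c f : bounded_mfun D f -> (forall x, D x -> `|f x| <= c) ->
  `|\int[mu]_(x in D) f x| <= c.
Proof.
move=> bf fc; apply: le_trans (mean_norm bf) _; rewrite -(mean_cst c).
by apply: le_mean => //; [exact: bounded_mfun_norm|exact: bounded_mfun_cst].
Qed.

Lemma EFin_mean f : bounded_mfun D f ->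
  (\int[mu]_(x in D) f x)%:E = (\int[mu]_(x in D) (f x)%:E)%E.
Proof. by move=> bf; rewrite fineK// integrable_fin_num//; exact: mint. Qed.

(** The variance is nonnegative. *)
Lemma mean_sqr_le f : bounded_mfun D f ->
  (\int[mu]_(x in D) f x) ^+ 2 <= \int[mu]_(x in D) f x ^+ 2.
Proof.
move=> bf; set m := \int[mu]_(x in D) f x.
have b2 : bounded_mfun D (fun x => f x ^+ 2) by exact: bounded_mfunX.
have bm : bounded_mfun D (fun x => 2 * m * f x).
  by apply: bounded_mfunM => //; exact: bounded_mfun_cst.
have : 0 <= \int[mu]_(x in D) ((f x ^+ 2 - 2 * m * f x) + m ^+ 2).
  by apply: Rintegral_ge0 => x _; have := sqr_ge0 (f x - m); lra.
rewrite meanD ?mean_cst ?meanB ?meanZ -/m; [lra|..] => //.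
- exact: bounded_mfunB.
- exact: bounded_mfun_cst.
Qed.

End mean.

(** * Integrals against densities and against the law of the data *)

Section density_integral.
Context (R : realType) (d : nat).
Implicit Types f : density R d.

Let restricted f : euclid R d -> R := pdf f \_ cube.

Let restricted_ge0 f x : 0 <= restricted f x.
Proof.
rewrite /restricted patchE; case: ifPn => // /set_mem.
exact: pdf_ge0.
Qed.

Let measurable_restricted f : measurable_fun [set: euclid R d] (restricted f).
Proof.
apply/(measurable_restrictT _ _).1; [exact: measurable_cube|exact: measurable_pdf].
Qed.

(** A law with density [f] is the mixture of the Dirac masses at [x], weighted by
    [f x]. *)
Lemma ge0_integral_density f (F : euclid R d -> \bar R) :
  measurable_fun [set: euclid R d] F -> (forall x, 0 <= F x)%E ->
  (\int[density_prob f]_x F x =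
   \int[lebesgue R d]_(x in cube) ((f x)%:E * F x))%E.
Proof.
move=> mF F0.
rewrite (@ge0_integral_mixture _ _ (euclid R d) _ _ (lebesgue R d)
  (fun x => mscale (NngNum (restricted_ge0 f x)) (dirac x)) (density_prob f))//.
- rewrite [RHS]integral_mkcond; apply: eq_integral => x _.
  rewrite ge0_integral_mscale// integral_dirac// diracT mul1e /= patchE /restricted patchE.
  by case: ifPn => // _; rewrite mul0e.
- move=> U mU; apply/emeasurable_funM.
    by apply/measurable_EFinP; exact: measurable_restricted.
  apply: measurable_fun_dirac => //.
- move=> U mU.
  transitivity (\int[lebesgue R d]_(x in cube `&` U) (f x)%:E)%E => //.
  rewrite [LHS]integral_mkcond.
  apply: eq_integral => x _; rewrite patchE in_setI.
  transitivity ((restricted f x)%:E * \d_x U)%E => //.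
  rewrite /restricted patchE diracE.
  by case: (x \in cube); case: (x \in U); rewrite /= ?mul0e ?mule1 ?mule0.
Qed.

End density_integral.

Section mean_density.
Context (R : realType) (d : nat).
Implicit Types (f : density R d) (u : euclid R d -> R).

Lemma density_prob_cube f : density_prob f cube = 1%E.
Proof. by rewrite /= /density_prob setIid integral_pdf. Qed.

Lemma density_integrable f : (lebesgue R d).-integrable cube (EFin \o pdf f).
Proof.
apply/integrableP; split; first by apply/measurable_EFinP; exact: measurable_pdf.
rewrite (eq_integral (EFin \o pdf f)).
  by rewrite integral_pdf ltry.
by move=> x /set_mem cx /=; rewrite ger0_norm// pdf_ge0.
Qed.

Lemma density_bounded_integrable f u : bounded_mfun cube u ->
  (lebesgue R d).-integrable cube (fun x => (f x * u x)%:E).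
Proof.
move=> [mu [M uM]].
have mc := @measurable_cube R d.
apply: (le_integrable mc _ _ (integrableZl mc M (density_integrable f))).
- by apply/measurable_EFinP/measurable_funM => //; exact: measurable_pdf.
- move=> x cx /=; rewrite lee_fin mulrC !normrM ler_wpM2r//.
  exact: le_trans (uM _ cx) (ler_norm _).
Qed.

(** Shifting [u] by a bound on its absolute value reduces this to nonnegative
    integrands. *)
Lemma mean_density f u : bounded_mfun [set: euclid R d] u ->
  \int[density_prob f]_x u x = \int[lebesgue R d]_(x in cube) (f x * u x).
Proof.
move=> bu; have [mu [M uM]] := bu.
have uM0 x : 0 <= u x + M by have := uM x I; rewrite ler_norml; lra.
have bM : bounded_mfun [set: euclid R d] (fun=> M) by exact: bounded_mfun_cst.
have buM := bounded_mfunD bu bM.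
have PT : density_prob f setT = 1%E by exact: probability_setT.
have mc := @measurable_cube R d.
have bcu : bounded_mfun cube u by exact: bounded_mfunS bu.
have : \int[density_prob f]_x (u x + M) =
       \int[lebesgue R d]_(x in cube) (f x * u x + f x * M).
  rewrite /Rintegral ge0_integral_density//.
    by congr fine; apply: eq_integral => x _; rewrite -EFinM mulrDr.
  by apply/measurable_EFinP; case: buM.
rewrite (meanD measurableT PT)// (mean_cst measurableT PT) RintegralD//; last 2 first.
- exact: density_bounded_integrable.
- by apply: density_bounded_integrable; exact: bounded_mfun_cst.
rewrite RintegralZr//; last exact: density_integrable.
by rewrite [X in X * M](_ : _ = 1) ?mul1r; [lra|rewrite /Rintegral integral_pdf].
Qed.

Lemma mean_density_cube f u : bounded_mfun [set: euclid R d] u ->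
  \int[density_prob f]_x u x = \int[density_prob f]_(x in cube) u x.
Proof.
move=> bu; have [mu [M uM]] := bu.
have mc := @measurable_cube R d.
have bcu : bounded_mfun [set: euclid R d] (u \_ cube).
  split; first exact/(measurable_restrictT _ _).1/measurable_funTS.
  exists M => x _; rewrite patchE; case: ifPn => _; first exact: uM.
  by rewrite normr0 (le_trans _ (uM x I)).
rewrite [RHS]Rintegral_mkcond mean_density// (mean_density f bcu).
by apply: eq_Rintegral => x xc; rewrite patchE xc.
Qed.

End mean_density.

Section law_rcons_integral.
Context (R : realType) (d k : nat) (dZ : measure_display)
  (Z : measurableType dZ).
Local Notation XZ := (euclid R d * Z)%type.
Variables (P : probability (k.-tuple XZ) R) (f : density R d)
  (q : R.-pker (euclid R d * k.-tuple Z) ~> Z).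
Local Notation WX := (k.-tuple XZ * euclid R d)%type.

Let append (p : WX * Z) : k.+1.-tuple XZ := rcons_tuple p.1.1 (p.1.2, p.2).

Let measurable_append : measurable_fun [set: WX * Z] append.
Proof.
apply: measurable_rcons; first exact: (measurableT_comp measurable_fst measurable_fst).
apply/measurable_fun_pairP; split; last exact: measurable_snd.
exact: (measurableT_comp measurable_snd measurable_fst).
Qed.

Let measurable_append_wx wx : measurable_fun [set: Z] (fun z => append (wx, z)).
Proof. exact: measurableT_comp measurable_append (pair1_measurable wx). Qed.

Lemma ge0_integral_law_rcons (F : k.+1.-tuple XZ -> \bar R) :
  measurable_fun [set: k.+1.-tuple XZ] F -> (forall w, 0 <= F w)%E ->
  (\int[law_rcons P f q]_w F w =
   \int[P \x density_prob f]_wx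
     \int[q (wx.2, map_tuple snd wx.1)]_z F (rcons_tuple wx.1 (wx.2, z)))%E.
Proof.
move=> mF F0.
pose K wx : {measure set _ -> \bar R} :=
  measure_function_pushforward__canonical__measure_function_Measure
    (kernel_past q wx) (measurable_append_wx wx).
rewrite (@ge0_integral_mixture _ _ WX _ _ (P \x density_prob f)%E K (law_rcons P f q))//.
- apply: eq_integral => wx _; rewrite ge0_integral_pushforward//.
- move=> U mU; rewrite (_ : (fun wx => _) =
      fun wx => kernel_past q wx (xsection (append @^-1` U) wx)); last first.
    by apply/funext => wx; rewrite xsectionE.
  apply: measurable_fun_xsection_finite_kernel; rewrite inE.
  by rewrite -[X in measurable X]setTI; exact: measurable_append.
Qed.

End law_rcons_integral.

(** * One private output *)

(** With [delta = E - m], the cross term of [(m + delta)^2] is absorbed by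
    [2 |m| eta s <= (eta m)^2 + s^2]. *)
Lemma chi_square_arith (R : realType) (E m s eta V : R) :
  `|E - m| <= eta * s -> s ^+ 2 <= V - m ^+ 2 ->
  E ^+ 2 <= (1 + eta ^+ 2) * V.
Proof.
move=> Em sV; have d2 : (E - m) ^+ 2 <= (eta * s) ^+ 2.
  by rewrite -(real_normK (num_real (E - m))) lerXn2r// nnegrE ?(le_trans _ Em).
have md : 2 * m * (E - m) <= (eta * m) ^+ 2 + s ^+ 2.
  have : `|m * (E - m)| <= `|m| * (eta * s) by rewrite normrM ler_wpM2l.
  have := sqr_ge0 (eta * `|m| - s); rewrite sqrrB !exprMn real_normK ?num_real//.
  by rewrite ler_norml; lra.
have -> : E ^+ 2 = m ^+ 2 + 2 * m * (E - m) + (E - m) ^+ 2 by ring.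
have : (1 + eta ^+ 2) * (s ^+ 2 + m ^+ 2) <= (1 + eta ^+ 2) * V.
  by rewrite ler_wpM2l ?addr_ge0 ?sqr_ge0//; lra.
by rewrite exprMn in d2 md *; lra.
Qed.

Section private_channel.
Context (R : realType) (d : nat) (dZ : measure_display) (Z : measurableType dZ).
Variable q : euclid R d -> {measure set Z -> \bar R}.
Hypothesis mq : forall U, measurable U -> measurable_fun [set: euclid R d] (q ^~ U).
Hypothesis q1 : forall x, q x setT = 1%E.
Variable a : R.
Hypothesis a1 : 1 <= a.
Hypothesis qa : forall x y U, cube x -> cube y -> measurable U ->
  (q x U <= a%:E * q y U)%E.
Implicit Types (phi psi : Z -> R) (f g : density R d).
Local Notation bounded := (@bounded_mfun _ Z R setT).

Let Eq phi x := \int[q x]_z phi z.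

Lemma channel_bounded phi : bounded phi -> bounded_mfun setT (Eq phi).
Proof.
move=> bphi; have [mphi [M phiM]] := bphi.
have M0 z : 0 <= phi z + M by have := phiM z I; rewrite ler_norml; lra.
have bM : bounded (fun=> M) by exact: bounded_mfun_cst.
split; last by exists M => x _; apply: mean_norm_le.
(* Measurability is known for integrals of nonnegative functions. *)
rewrite (_ : Eq phi = fun x => fine (\int[q x]_z (phi z + M)%:E)%E - M).
  apply: measurable_funB => //; apply: measurableT_comp => //.
  apply: measurable_fun_integral_kernel => //.
    by apply/measurable_EFinP; apply: measurable_funD.
by apply/funext => x; have := meanD measurableT (q1 x) bphi bM;
  rewrite (mean_cst measurableT (q1 x)) /Rintegral /Eq => ->; rewrite addrK.
Qed.

Let privacy_ge0 phi x y : cube x -> cube y -> bounded phi ->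
  (forall z, 0 <= phi z) -> Eq phi x <= a * Eq phi y.
Proof.
move=> cx cy bphi phi0.
have a0 : 0 <= a by exact: le_trans ler01 a1.
rewrite -lee_fin EFinM /Eq !EFin_mean//.
rewrite -[leRHS]/(((NngNum a0)%:num)%:E * _)%E -ge0_integral_mscale//; last 2 first.
- by apply/measurable_EFinP; case: bphi.
- by move=> z _; rewrite lee_fin.
apply: ge0_le_measure_integral => //.
- by move=> U mU; exact: (qa cx cy mU).
- by apply/measurable_EFinP; case: bphi.
Qed.

(** The positive and negative parts of [phi] are handled separately, as the
    privacy constraint compares integrals of nonnegative functions only. *)
Let privacy_diff phi x y : cube x -> cube y -> bounded phi ->
  `|Eq phi x - Eq phi y| <= (a - 1) * Eq (fun z => `|phi z|) y.
Proof.
move=> cx cy bphi.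
have bn := bounded_mfun_norm bphi.
pose p z := (`|phi z| + phi z) / 2; pose n z := (`|phi z| - phi z) / 2.
have bh : bounded (fun=> 2^-1) by exact: bounded_mfun_cst.
have bp : bounded p by apply: bounded_mfunM => //; exact: bounded_mfunD.
have bm : bounded n by apply: bounded_mfunM => //; exact: bounded_mfunB.
have p0 z : 0 <= p z by have := ler_norm (- phi z); rewrite /p normrN; lra.
have n0 z : 0 <= n z by have := ler_norm (phi z); rewrite /n; lra.
have Ephi t : Eq phi t = Eq p t - Eq n t.
  rewrite /Eq -(meanB measurableT (q1 t))//.
  by apply: eq_Rintegral => z _; rewrite /p /n; lra.
have En t : Eq (fun z => `|phi z|) t = Eq p t + Eq n t.
  rewrite /Eq -(meanD measurableT (q1 t))//.
  by apply: eq_Rintegral => z _; rewrite /p /n; lra.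
have Ep0 : 0 <= Eq p y by apply: Rintegral_ge0.
have En0 : 0 <= Eq n y by apply: Rintegral_ge0.
have := privacy_ge0 cx cy bp p0; have := privacy_ge0 cy cx bp p0.
have := privacy_ge0 cx cy bm n0; have := privacy_ge0 cy cx bm n0.
rewrite Ephi En (Ephi y) ler_norml.
move: (Eq p x) (Eq n x) (Eq p y) (Eq n y) Ep0 En0 => P N P' N' P0 N0 h1 h2 h3 h4.
have key (U V : R) : 0 <= V -> U <= a * V -> V <= a * U -> V - U <= (a - 1) * V.
  move=> V0 UV VU; have [UleV|] := leP U V; last by have := a1; nra.
  by have := a1; nra.
have := key P P' P0 h4 h3; have := key N N' N0 h2 h1.
by rewrite mulrDr; lra.
Qed.

(** Let [m] be the mean of [phi] under [f] and [psi = phi - m].  As [Eq psi]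
    has mean zero under [f], privacy bounds [|Eq psi x|] on the cube, uniformly
    in [x], by [a - 1] times the mean of [|psi|] under [f].  Hence
    moving from [f] to [g] changes the mean of [phi] by at most [(a - 1) * tau]
    times the standard deviation of [phi] under [f]. *)
Lemma channel_chi_square f g tau phi :
  \int[lebesgue R d]_(x in cube) `|g x - f x| <= tau ->
  bounded phi ->
  (\int[density_prob g]_x Eq phi x) ^+ 2 <=
  (1 + ((a - 1) * tau) ^+ 2) * \int[density_prob f]_x Eq (fun z => phi z ^+ 2) x.
Proof.
move=> fgtau bphi.
have mc := @measurable_cube R d.
have fc := density_prob_cube f.
have fT : density_prob f setT = 1%E by exact: probability_setT.
pose m := \int[density_prob f]_x Eq phi x.
pose psi z := phi z - m.
have bc (c : R) : bounded (fun=> c) by exact: bounded_mfun_cst.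
have bC (c : R) : bounded_mfun [set: euclid R d] (fun=> c) by exact: bounded_mfun_cst.
have bpsi : bounded psi by apply: bounded_mfunB.
have bn := bounded_mfun_norm bpsi.
have Epsi x : Eq psi x = Eq phi x - m.
  by rewrite /Eq (meanB measurableT (q1 x))// (mean_cst measurableT (q1 x)).
have bEphi := channel_bounded bphi.
have bEpsi := channel_bounded bpsi.
have bEn := channel_bounded bn.
have b2 := bounded_mfunX 2 bphi.
have b2' := bounded_mfunX 2 bpsi.
have bE2 := channel_bounded b2.
have mpsi0 : \int[density_prob f]_x Eq psi x = 0.
  under eq_Rintegral do rewrite Epsi.
  by rewrite (meanB measurableT fT)// (mean_cst measurableT fT) subrr.
set s := \int[density_prob f]_x Eq (fun z => `|psi z|) x.
have cubeS (u : euclid R d -> R) : bounded_mfun setT u -> bounded_mfun (@cube R d) u.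
  by apply: bounded_mfunS.
(* [psi] has mean zero under [f], so [Eq psi x] is an average of differences. *)
have psi_le x : cube x -> `|Eq psi x| <= (a - 1) * s.
  move=> cx.
  have -> : Eq psi x = \int[density_prob f]_(y in cube) (Eq psi x - Eq psi y).
    rewrite (meanB mc fc) ?(mean_cst mc fc) -?mean_density_cube//; last 2 first.
    - exact/cubeS.
    - exact/cubeS.
    by rewrite mpsi0 subr0.
  have bd : bounded_mfun cube (fun y => Eq psi x - Eq psi y).
    by apply/cubeS/bounded_mfunB.
  apply: le_trans (mean_norm mc fc bd) _.
  rewrite /s mean_density_cube// -(meanZ mc fc); last exact/cubeS.
  apply: (le_mean mc fc).
  - exact: bounded_mfun_norm.
  - by apply: bounded_mfunM; apply/cubeS.
  - by move=> y cy; exact: privacy_diff.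
have s2 : s ^+ 2 <= \int[density_prob f]_x Eq (fun z => phi z ^+ 2) x - m ^+ 2.
  apply: le_trans (mean_sqr_le measurableT fT bEn) _.
  have -> : \int[density_prob f]_x Eq (fun z => phi z ^+ 2) x - m ^+ 2 =
     \int[density_prob f]_x Eq (fun z => psi z ^+ 2) x.
    transitivity (\int[density_prob f]_x
        (Eq (fun z => phi z ^+ 2) x - (2 * m * Eq phi x - m ^+ 2))).
      rewrite (meanB measurableT fT)//; last first.
        by apply: bounded_mfunB => //; apply: bounded_mfunM.
      rewrite (meanB measurableT fT)//; last by apply: bounded_mfunM.
      by rewrite (meanZ measurableT fT)// (mean_cst measurableT fT) -/m; ring.
    apply: eq_Rintegral => x _.
    rewrite /Eq -(mean_cst measurableT (q1 x) (m ^+ 2)) -(meanZ measurableT (q1 x))//.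
    rewrite -(meanB measurableT (q1 x))//; last by apply: bounded_mfunM.
    rewrite -(meanB measurableT (q1 x))//; last first.
      by apply: bounded_mfunB => //; apply: bounded_mfunM.
    by apply: eq_Rintegral => z _; rewrite /psi; ring.
  apply: (le_mean measurableT fT) => //.
  - exact: bounded_mfunX.
  - exact: channel_bounded.
  - move=> x _; apply: le_trans (mean_sqr_le measurableT (q1 x) bn) _.
    by under eq_Rintegral do rewrite real_normK ?num_real//.
have s0 : 0 <= s.
  by apply: Rintegral_ge0 => x _; apply: Rintegral_ge0.
(* Subtracting the constant [m] is harmless, as [f] and [g] have the same mass. *)
have diff : `|\int[density_prob g]_x Eq phi x - m| <= (a - 1) * tau * s.
  have -> : \int[density_prob g]_x Eq phi x - m =
      \int[lebesgue R d]_(x in cube) ((g x - f x) * Eq psi x).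
    transitivity (\int[density_prob g]_x Eq psi x - \int[density_prob f]_x Eq psi x).
      rewrite mpsi0 subr0; under [RHS]eq_Rintegral do rewrite Epsi.
      rewrite (meanB measurableT)// ?(mean_cst measurableT)//; exact: probability_setT.
    rewrite !mean_density// -RintegralB//; last 2 first.
    - by apply: density_bounded_integrable; exact/cubeS.
    - by apply: density_bounded_integrable; exact/cubeS.
    by apply: eq_Rintegral => x _; rewrite mulrBl.
  have int1 : (lebesgue R d).-integrable cube (EFin \o (fun x => g x - f x)).
    exact: (integrableB mc (density_integrable g) (density_integrable f)).
  have int2 : (lebesgue R d).-integrable cube (EFin \o (fun x => (g x - f x) * Eq psi x)).
    rewrite (_ : _ \o _ = (fun x => (g x * Eq psi x)%:E) \-
        (fun x => (f x * Eq psi x)%:E))%E; last first.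
      by apply/funext => x; rewrite /= mulrBl.
    exact: (integrableB mc (density_bounded_integrable g (cubeS _ bEpsi))
      (density_bounded_integrable f (cubeS _ bEpsi))).
  apply: le_trans (le_normr_Rintegral mc int2) _.
  apply: (@le_trans _ _ (\int[lebesgue R d]_(x in cube) (`|g x - f x| * ((a - 1) * s)))).
    apply: le_Rintegral => //.
    - exact: integrable_norm.
    - exact: (integrableZr mc ((a - 1) * s) (integrable_norm int1)).
    - by move=> x cx; rewrite normrM ler_wpM2l// psi_le.
  rewrite RintegralZr//; last exact: integrable_norm.
  by rewrite [leRHS]mulrAC [leRHS]mulrC ler_wpM2r// mulr_ge0// subr_ge0.
exact: chi_square_arith diff s2.
Qed.

End private_channel.

(** * The transcript of an interactive mechanism *)

Section transcript.
Context (R : realType) (d : nat) (dZ : measure_display) (Z : measurableType dZ).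

Definition is_test (dT : measure_display) (T : measurableType dT) (phi : T -> R) :=
  measurable_fun setT phi /\ forall z, 0 <= phi z <= 1.

Lemma test_bounded (dT : measure_display) (T : measurableType dT) (phi : T -> R) :
  is_test phi -> bounded_mfun setT phi.
Proof.
by move=> [mphi phi01]; split=> //; exists 1 => z _; have := phi01 z; rewrite ler_norml; lra.
Qed.

Lemma test_sqr (dT : measure_display) (T : measurableType dT) (phi : T -> R) :
  is_test phi -> is_test (fun z => phi z ^+ 2).
Proof.
move=> [mphi phi01]; split; first exact: measurable_funX.
by move=> z; have := phi01 z => /andP[h0 h1]; rewrite sqr_ge0/= expr_le1.
Qed.

Lemma test_mean (dT : measure_display) (T : measurableType dT) (P : {measure set T -> \bar R})
  (phi : T -> R) : P setT = 1%E -> is_test phi -> 0 <= \int[P]_x phi x <= 1.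
Proof.
move=> P1 tphi; have [mphi phi01] := tphi.
apply/andP; split; first by apply: Rintegral_ge0 => z _; have /andP[] := phi01 z.
rewrite -(mean_cst measurableT P1 1); apply: (le_mean measurableT P1).
- exact: test_bounded.
- exact: bounded_mfun_cst.
- by move=> z _; have /andP[] := phi01 z.
Qed.

Section one_more_output.
Variables (k : nat) (q : R.-pker (euclid R d * k.-tuple Z) ~> Z).
Implicit Types (phi : k.+1.-tuple Z -> R) (f : density R d).

Definition output_mean phi (x : euclid R d) (z : k.-tuple Z) : R :=
  \int[q (x, z)]_z' phi (rcons_tuple z z').

(** The conditional mean of [phi], given the previous outputs [z], when the new input
    has density [f]. *)
Definition next_mean f phi (z : k.-tuple Z) : R :=
  \int[density_prob f]_x output_mean phi x z.

Let q1 xz : q xz setT = 1%E. Proof. exact: prob_kernel. Qed.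
Let f1 f : density_prob f setT = 1%E. Proof. exact: probability_setT. Qed.

Lemma test_rcons phi z : is_test phi -> is_test (fun z' => phi (rcons_tuple z z')).
Proof.
move=> [mphi phi01]; split => //; apply: measurableT_comp mphi _.
exact: measurable_rcons.
Qed.

Let EFin_output phi x z : is_test phi ->
  (output_mean phi x z)%:E = (\int[q (x, z)]_z' (phi (rcons_tuple z z'))%:E)%E.
Proof.
move=> tphi; rewrite (EFin_mean measurableT)//.
exact/test_bounded/test_rcons.
Qed.

Lemma test_output phi : is_test phi -> is_test (fun xz => output_mean phi xz.1 xz.2).
Proof.
move=> tphi; split; last by move=> -[x z]; apply: test_mean => //; exact: test_rcons.
have [mphi phi01] := tphi.
apply/measurable_EFinP.
rewrite (_ : _ \o _ = fun xz => (\int[q xz]_z'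
    (EFin \o (fun p : (euclid R d * k.-tuple Z) * Z =>
      phi (rcons_tuple p.1.2 p.2))) (xz, z'))%E); last first.
  by apply/funext => -[x z] /=; rewrite EFin_output.
apply: measurable_fun_integral_finite_kernel.
  by move=> z; rewrite lee_fin; have /andP[] := phi01 (rcons_tuple z.1.2 z.2).
apply/measurable_EFinP; apply: measurableT_comp mphi _.
apply: measurable_rcons => //; exact: (measurableT_comp measurable_snd measurable_fst).
Qed.

Lemma test_output_x phi z : is_test phi -> is_test (output_mean phi ^~ z).
Proof.
move=> tphi; have [mo o01] := test_output tphi; split; last by move=> x; exact: (o01 (x, z)).
exact: measurableT_comp mo (pair2_measurable z).
Qed.

Lemma test_next f phi : is_test phi -> is_test (next_mean f phi).
Proof.
move=> tphi; split; last first.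
  by move=> z; apply: test_mean; [exact: f1|exact: test_output_x].
have [mo o01] := test_output tphi.
apply/measurable_EFinP.
rewrite (_ : _ \o _ = fun z => (\int[density_prob f]_x
    (EFin \o (fun xz => output_mean phi xz.1 xz.2)) (x, z))%E); last first.
  apply/funext => z /=; rewrite (EFin_mean measurableT (f1 f))//.
  exact/test_bounded/test_output_x.
apply: measurable_fun_fubini_tonelli_G.
  exact/measurable_EFinP.
by move=> xz; rewrite lee_fin; have /andP[] := o01 xz.
Qed.

Lemma mean_law_rcons (P : probability (k.-tuple (euclid R d * Z)%type) R) f phi :
  is_test phi ->
  \int[law_rcons P f q]_w phi (map_tuple snd w) =
  \int[P]_w next_mean f phi (map_tuple snd w).
Proof.
move=> tphi; have [mphi phi01] := tphi.
have [mo o01] := test_output tphi.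
have msnd j := @measurable_map_snd _ _ (euclid R d) Z j.
congr fine; rewrite ge0_integral_law_rcons; last 2 first.
- by apply/measurable_EFinP; exact: measurableT_comp mphi (msnd _).
- by move=> w; rewrite lee_fin; have /andP[] := phi01 (map_tuple snd w).
transitivity (\int[P \x density_prob f]_wx (output_mean phi wx.2 (map_tuple snd wx.1))%:E)%E.
  apply: eq_integral => -[w x] _; rewrite EFin_output//.
  apply: eq_integral => z _ /=; congr (phi _)%:E; apply: val_inj => /=.
  by rewrite map_rcons.
have mswap : measurable_fun [set: k.-tuple (euclid R d * Z) * euclid R d]
    (fun wx => (wx.2, map_tuple snd wx.1)).
  apply/measurable_fun_pairP; split => /=; first exact: measurable_snd.
  exact: measurableT_comp (msnd _) measurable_fst.
rewrite fubini_tonelli1/=; last 2 first.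
- by apply/measurable_EFinP; exact: (measurableT_comp mo mswap).
- by move=> wx; rewrite lee_fin; have /andP[] := o01 (wx.2, map_tuple snd wx.1).
apply: eq_integral => w _; rewrite /fubini_F/= (EFin_mean measurableT (f1 f))//.
exact/test_bounded/test_output_x.
Qed.

Lemma next_mean_chi_square (a tau : R) (f g : density R d) phi z : 1 <= a ->
  (forall x y U, cube x -> cube y -> measurable U ->
    q (x, z) U <= a%:E * q (y, z) U)%E ->
  \int[lebesgue R d]_(x in cube) `|g x - f x| <= tau -> is_test phi ->
  next_mean g phi z ^+ 2 <=
  (1 + ((a - 1) * tau) ^+ 2) * next_mean f (fun z => phi z ^+ 2) z.
Proof.
move=> a1 qa fg tphi.
apply: (@channel_chi_square _ _ _ _ (fun x => q (x, z)) _ _ a a1 qa f g tau) => //.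
- by move=> U mU; exact: measurableT_comp (measurable_kernel q U mU) (pair2_measurable z).
- exact/test_bounded/test_rcons.
Qed.

End one_more_output.

Section likelihood.
Variables (n : nat) (Q : mechanism R d n Z) (a tau : R) (f g : density R d).
Hypothesis a1 : 1 <= a.
Hypothesis Qa : forall i z x y U, cube x -> cube y -> measurable U ->
    (Q i (x, z) U <= a%:E * Q i (y, z) U)%E.
Hypothesis fg : \int[lebesgue R d]_(x in cube) `|g x - f x| <= tau.

(** Integrating out the last output multiplies the constant by the factor of a
    single output, conditionally on the past; what is left is a test function of
    one output less. *)
Lemma transcript_chi_square k (kn : (k <= n)%N) (phi : k.-tuple Z -> R) :
  is_test phi ->
  (\int[joint_law Q g kn]_w phi (map_tuple snd w)) ^+ 2 <=
  (1 + ((a - 1) * tau) ^+ 2) ^+ k *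
    \int[joint_law Q f kn]_w phi (map_tuple snd w) ^+ 2.
Proof.
have msnd j := @measurable_map_snd _ _ (euclid R d) Z j.
pose C := 1 + ((a - 1) * tau) ^+ 2; rewrite -/C.
have C0 : 0 <= C by rewrite addr_ge0 ?sqr_ge0.
elim: k kn phi => [|k ih] kn phi tphi.
  rewrite expr0 mul1r.
  under eq_Rintegral do rewrite tuple0.
  under [leRHS]eq_Rintegral do rewrite tuple0.
  by rewrite !(mean_cst measurableT)//=; exact: diracT.
(* The factor of the last output is taken inside the mean over the past. *)
pose P h := joint_law Q h (ltnW kn).
have Eg : \int[joint_law Q g kn]_w phi (map_tuple snd w) =
    \int[P g]_w next_mean (Q (Ordinal kn)) g phi (map_tuple snd w).
  exact: mean_law_rcons.
have Ef : \int[joint_law Q f kn]_w phi (map_tuple snd w) ^+ 2 =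
    \int[P f]_w next_mean (Q (Ordinal kn)) f (fun z => phi z ^+ 2) (map_tuple snd w).
  exact: (mean_law_rcons (Q (Ordinal kn)) (P f) f (test_sqr tphi)).
rewrite Eg Ef.
apply: le_trans (ih _ _ (test_next _ g tphi)) _.
rewrite (exprS C k) [leRHS]mulrAC [leRHS]mulrC ler_wpM2l ?exprn_ge0//.
have P1 : P f setT = 1%E by exact: probability_setT.
have bsnd (u : k.-tuple Z -> R) : is_test u ->
    bounded_mfun setT (fun w : k.-tuple (euclid R d * Z) => u (map_tuple snd w)).
  by move=> [mu u01]; apply: test_bounded; split => //; exact: measurableT_comp mu (msnd _).
have bf := bsnd _ (test_next (Q (Ordinal kn)) f (test_sqr tphi)).
have bg := bsnd _ (test_next (Q (Ordinal kn)) g tphi).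
have EC := meanZ measurableT P1 C bf; rewrite -EC.
apply: (le_mean measurableT P1).
- exact: bounded_mfunX.
- by apply: bounded_mfunM => //; exact: bounded_mfun_cst.
- move=> w _; exact: (next_mean_chi_square a1 (@Qa (Ordinal kn) _) fg tphi).
Qed.

End likelihood.

End transcript.

(** * Indistinguishability under local privacy *)

Section overlap.
Context (R : realType) (d n : nat) (dZ : measure_display) (Z : measurableType dZ).
Variables (Q : mechanism R d n Z) (alpha : R).
Hypothesis alpha0 : 0 < alpha.
Hypothesis Qalpha : ldp alpha Q.

(** The ratio in the definition of privacy is [+oo] when only its denominator
    vanishes, so the bound also holds for sets of measure zero. *)
Lemma ldp_le i z x y U : cube x -> cube y -> measurable U ->
  (Q i (x, z) U <= (expR alpha)%:E * Q i (y, z) U)%E.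
Proof.
move=> cx cy mU.
have : (Q i (x, z) U / Q i (y, z) U <= (expR alpha)%:E)%E.
  apply: (le_trans _ (@Qalpha i z x y cx cy)).
  by apply: ereal_sup_ubound; exists U.
have ge0 t : (0 <= Q i (t, z) U)%E by apply: measure_ge0.
have fin t : Q i (t, z) U \is a fin_num.
  rewrite ge0_fin_numE//; apply: (@le_lt_trans _ _ 1%E); last exact: ltry.
  by rewrite -(@prob_kernel _ _ _ _ _ (Q i) (t, z)) le_measure ?inE.
move: (fin x) (fin y) (ge0 x) (ge0 y).
case: (Q i (x, z) U) => // u _; case: (Q i (y, z) U) => // v _.
rewrite !lee_fin => u0 v0.
have [->|vN0] := eqVneq v 0.
  rewrite inve0 mulr0.
  have [->|uN0] := eqVneq u 0; first by [].
  by rewrite gt0_muley// lte_fin lt_neqAle eq_sym uN0.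
rewrite inver (negbTE vN0) -!EFinM !lee_fin ler_pdivrMr//.
by rewrite lt_neqAle eq_sym vN0.
Qed.

(** From [(1 + x)^m (1 - m x) <= 1], whose left-hand side is nonincreasing in [m]. *)
Lemma bernoulli_le2 (x : R) (m : nat) : 0 <= x -> m%:R * x <= 2^-1 -> (1 + x) ^+ m <= 2.
Proof.
move=> x0 mx.
have key k : (1 + x) ^+ k * (1 - k%:R * x) <= 1.
  elim: k => [|k ih]; first by rewrite expr0; lra.
  apply: le_trans ih; rewrite exprSr -mulrA ler_wpM2l ?exprn_ge0 ?addr_ge0//.
  rewrite -natr1; have : 0 <= k%:R * x ^+ 2 by rewrite mulr_ge0 ?sqr_ge0.
  by have := sqr_ge0 x; lra.
have := key m; have : 0 <= (1 + x) ^+ m by rewrite exprn_ge0 ?addr_ge0.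
by nra.
Qed.

(** With [x = Eg], the chi-square bound gives [x^2 <= 2 * Ef], so that the sum of
    the two errors is at least [x^2 / 2 + 1 - x], and hence at least [1 / 2]. *)
Lemma transcript_overlap (f g : density R d) (tau : R) (phi psi : n.-tuple Z -> R) :
  \int[lebesgue R d]_(x in cube) `|g x - f x| <= tau ->
  n%:R * ((expR alpha - 1) * tau) ^+ 2 <= 2^-1 ->
  is_test phi -> is_test psi -> (forall z, 1 <= phi z + psi z) ->
  2^-1 <= \int[joint_law Q f (leqnn n)]_w phi (map_tuple snd w) +
          \int[joint_law Q g (leqnn n)]_w psi (map_tuple snd w).
Proof.
move=> fg ntau tphi tpsi phipsi.
have msnd := @measurable_map_snd _ _ (euclid R d) Z n.
have bsnd (u : n.-tuple Z -> R) : is_test u ->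
    is_test (fun w : n.-tuple (euclid R d * Z) => u (map_tuple snd w)).
  by move=> [mu u01]; split => //; exact: measurableT_comp mu msnd.
have P1 h : joint_law Q h (leqnn n) setT = 1%E by exact: probability_setT.
have tphi2 := test_sqr tphi.
have a1 : 1 <= expR alpha by rewrite ltW// expR_gt1.
have chi := transcript_chi_square a1 ldp_le fg (leqnn n) tphi.
set Ef := \int[joint_law Q f (leqnn n)]_w phi (map_tuple snd w).
set Eg := \int[joint_law Q g (leqnn n)]_w phi (map_tuple snd w) in chi *.
have sqr_le : \int[joint_law Q f (leqnn n)]_w phi (map_tuple snd w) ^+ 2 <= Ef.
  apply: (le_mean measurableT (P1 f)).
  - exact: test_bounded (bsnd _ tphi2).
  - exact: test_bounded (bsnd _ tphi).
  move=> w _; have [_ phi01] := tphi; have /andP[h0 h1] := phi01 (map_tuple snd w).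
  by rewrite expr2 ler_piMl.
have psi_ge : 1 - Eg <= \int[joint_law Q g (leqnn n)]_w psi (map_tuple snd w).
  rewrite -(mean_cst measurableT (P1 g) 1) -(meanB measurableT (P1 g)); last 2 first.
  - exact: bounded_mfun_cst.
  - exact/test_bounded/bsnd.
  apply: (le_mean measurableT (P1 g)).
  - by apply: bounded_mfunB; [exact: bounded_mfun_cst|exact: test_bounded (bsnd _ tphi)].
  - exact/test_bounded/bsnd.
  - by move=> w _; have := phipsi (map_tuple snd w); lra.
have chi2 : Eg ^+ 2 <= 2 * Ef.
  apply: le_trans chi _; apply: ler_pM => //.
  - by rewrite exprn_ge0// addr_ge0 ?sqr_ge0.
  - by apply: Rintegral_ge0 => w _; exact: sqr_ge0.
  - by apply: bernoulli_le2 => //; exact: sqr_ge0.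
by have := sqr_ge0 (Eg - 1); lra.
Qed.

End overlap.

(** * Integrals over the cube *)

Section cube_integral.
Context (R : realType).
Local Notation lam := (@lebesgue_measure R).

Definition cons_point d (p : (measurableTypeR R * euclid R d)%type) : euclid R d.+1 :=
  [tuple of p.1 :: p.2].

Lemma measurable_cons_point d : measurable_fun setT (@cons_point d).
Proof. exact: measurable_cons. Qed.

Lemma cons_point_cube d :
  @cons_point d @^-1` cube = `[0, 1]%classic `*` cube.
Proof.
apply/seteqP; split => -[a y] /=.
  move=> c; split=> [|i]; first by have := c ord0; rewrite in_itv.
  by have := c (lift ord0 i); rewrite tnthS.
move=> -[ca cy] i; case: (unliftP ord0 i) => [j ->|->].
  by rewrite tnthS; exact: cy.
by move: ca; rewrite in_itv.
Qed.

Lemma lebesgue01 : lam `[0, 1]%classic = 1%E.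
Proof. by rewrite lebesgue_measure_itv/= lte_fin ltr01 -EFinB subr0. Qed.

Lemma lebesgue_cube d : lebesgue R d cube = 1%E.
Proof.
elim: d => [|d ih].
  rewrite /= diracE mem_set// => i; by case: i.
rewrite [LHS](_ : _ = (lam \x lebesgue R d)%E (`[0, 1]%classic `*` cube)).
  rewrite product_measure1E//; last exact: measurable_cube.
  by rewrite ih mule1; exact: lebesgue01.
by rewrite -cons_point_cube.
Qed.

Lemma Rintegral_cons d (v : euclid R d.+1 -> R) : bounded_mfun setT v ->
  \int[lebesgue R d.+1]_(x in cube) v x =
  \int[lam]_(a in `[0, 1]%classic) \int[lebesgue R d]_(y in cube) v (cons_point (a, y)).
Proof.
move=> bv.
have [mv [M vM]] := bv.
have mc := @measurable_cube R d.
have mc1 := @measurable_cube R d.+1.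
have mcons := @measurable_cons_point d.
have mD : measurable (@cons_point d @^-1` cube).
  by rewrite -[X in measurable X]setTI; exact: mcons.
have bvc : bounded_mfun setT (v \o @cons_point d).
  by split; [exact: measurableT_comp mv mcons|exists M => p _; exact: vM].
have muD : (lam \x lebesgue R d)%E (@cons_point d @^-1` cube) = 1%E.
  by rewrite -(lebesgue_cube d.+1).
have iD : (lam \x lebesgue R d)%E.-integrable (@cons_point d @^-1` cube)
    (EFin \o (v \o @cons_point d)).
  have muDoo : ((lam \x lebesgue R d)%E (@cons_point d @^-1` cube) < +oo)%E.
    by rewrite muD ltry.
  exact: (bounded_mfun_integrable mD muDoo (bounded_mfunS measurableT _ bvc)).
have bslice a : bounded_mfun cube (fun y => v (cons_point (a, y))).
  apply: (@bounded_mfunS _ _ _ _ setT) => //; split; last by exists M => y _; exact: vM.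
  exact: measurableT_comp bvc.1 (pair1_measurable a).
rewrite /Rintegral; congr fine.
transitivity (\int[pushforward (lam \x lebesgue R d)%E (@cons_point d)]_(x in cube) (v x)%:E)%E.
  by apply: eq_measure_integral.
rewrite integral_pushforward//; last by apply/measurable_EFinP.
rewrite integral_mkcond -integral12_prod_meas1; last first.
  by apply/integrable_restrict => //; rewrite setTI.
rewrite [RHS]integral_mkcond; apply: eq_integral => a _.
rewrite patchE; case: ifPn => a01.
  rewrite /fubini_F (EFin_mean mc (lebesgue_cube d) (bslice a)) [RHS]integral_mkcond.
  apply: eq_integral => y _; rewrite !patchE cons_point_cube.
  by rewrite in_setX/= a01.
rewrite /fubini_F integral0_eq// => y _; rewrite patchE cons_point_cube.
by rewrite in_setX/= (negbTE a01).
Qed.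

Lemma bounded_mfun_prod (dT : measure_display) (T : measurableType dT)
    (I : finType) (D : set T) (F : I -> T -> R) :
  (forall i, bounded_mfun D (F i)) -> bounded_mfun D (fun x => \prod_i F i x).
Proof.
move=> bF; elim: (index_enum I) => [|i r ih].
  by under [X in bounded_mfun _ X]eq_fun do rewrite big_nil; exact: bounded_mfun_cst.
by under [X in bounded_mfun _ X]eq_fun do rewrite big_cons; exact: bounded_mfunM.
Qed.

Lemma bounded_mfun_tensor d (u : 'I_d -> R -> R) :
  (forall m, bounded_mfun [set: measurableTypeR R] (u m)) ->
  bounded_mfun [set: euclid R d] (fun x => \prod_(m < d) u m (tnth x m)).
Proof.
move=> bu; apply: bounded_mfun_prod => m; have [mu [M uM]] := bu m.
split; last by exists M => x _; exact: uM.
exact: measurableT_comp mu (measurable_tnth m).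
Qed.

(** All integrals over the cube reduce to dimension one through this formula. *)
Lemma Rintegral_tensor d (u : 'I_d -> R -> R) :
  (forall m, bounded_mfun [set: measurableTypeR R] (u m)) ->
  \int[lebesgue R d]_(x in cube) \prod_(m < d) u m (tnth x m) =
  \prod_(m < d) \int[lam]_(t in `[0, 1]%classic) u m t.
Proof.
elim: d u => [|d ih] u bu.
  rewrite big_ord0; under eq_Rintegral do rewrite big_ord0.
  by rewrite mean_cst//; [exact: measurable_cube|exact: lebesgue_cube].
rewrite Rintegral_cons; last exact: bounded_mfun_tensor.
rewrite big_ord_recl -ih => [|m]; last exact: bu.
have m01 : measurable (`[0, 1]%classic : set (measurableTypeR R)) by [].
have b01 m : @bounded_mfun _ (measurableTypeR R) R `[0, 1]%classic (u m).
  exact: bounded_mfunS (bu m).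
have l01 : (lam `[0%R, 1%R]%classic < +oo)%E by rewrite lebesgue01 ltry.
rewrite -(RintegralZr _ m01 (bounded_mfun_integrable m01 l01 (b01 _))).
apply: eq_Rintegral => a _.
rewrite -(meanZ (@measurable_cube R d) (lebesgue_cube d)); last first.
  apply: (@bounded_mfunS _ _ _ _ setT) => //.
  by apply: (@bounded_mfun_tensor d (fun m => u (lift ord0 m))) => m; exact: bu.
apply: eq_Rintegral => y _; rewrite big_ord_recl /=; congr (_ * _).
by apply: eq_bigr => m _; rewrite tnthS.
Qed.

End cube_integral.

(** * Orthonormality of the Fourier basis in dimension one *)

Section fourier_orthonormal.
Context (R : realType).
Local Notation lam := (@lebesgue_measure R).
Local Notation I01 := (`[0%R, 1%R]%classic : set (measurableTypeR R)).
Local Notation bounded := (@bounded_mfun _ (measurableTypeR R) R setT).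

(** Integer frequencies of either sign, so that sums and differences of frequencies
    are treated alike in the product-to-sum formulas. *)
Definition wave (z : int) (t : R) : R := 2 * pi * z%:~R * t.

Lemma measurable_wave z : measurable_fun [set: measurableTypeR R] (wave z).
Proof. exact: measurable_funM. Qed.

Lemma bounded_cos_wave z : bounded (fun t => cos (wave z t)).
Proof.
split; last by exists 1 => t _; rewrite ler_norml cos_geN1 cos_le1.
have mcos := continuous_measurable_fun (@continuous_cos R).
exact: (measurableT_comp mcos (measurable_wave z)).
Qed.

Lemma bounded_sin_wave z : bounded (fun t => sin (wave z t)).
Proof.
split; last by exists 1 => t _; rewrite ler_norml sin_geN1 sin_le1.
have msin := continuous_measurable_fun (@continuous_sin R).
exact: (measurableT_comp msin (measurable_wave z)).
Qed.

Lemma sin_cos_2pi_int (z : int) : sin (2 * pi * z%:~R : R) = 0 /\ cos (2 * pi * z%:~R : R) = 1.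
Proof.
have nat_case (n : nat) : sin (2 * pi * n%:R : R) = 0 /\ cos (2 * pi * n%:R : R) = 1.
  have -> : 2 * pi * n%:R = 0 + (pi *+ 2) *+ n :> R.
    by rewrite add0r -[RHS]mulr_natr -[pi *+ 2]mulr_natl.
  by rewrite (periodicn (@sinD2pi R)) (periodicn (@cosD2pi R)) sin0 cos0.
case: z => n; first exact: nat_case.
have [sn cn] := nat_case n.+1.
by rewrite NegzE mulrNz mulrN sinN cosN -pmulrn sn cn oppr0.
Qed.

Lemma is_derive_wave z (t : R) : is_derive t (1 : R) (wave z) (2 * pi * z%:~R).
Proof.
have := is_deriveZ (2 * pi * z%:~R : R) (is_derive_id t (1 : R)).
by rewrite -[X in is_derive _ _ _ X]/(_ * _) mulr1.
Qed.

Lemma Rintegral01_FTC (F f : R -> R) :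
  (forall t : R, is_derive t 1 F (f t)) -> continuous f ->
  \int[lam]_(t in I01) f t = F 1 - F 0.
Proof.
move=> dF cf.
have derF t : derivable F t 1 by have [] := dF t.
have cF : continuous F by move=> t; apply/differentiable_continuous/derivable1_diffP.
rewrite /Rintegral (@continuous_FTC2 _ f F 0 1)//.
- exact: continuous_subspaceT.
- split => //.
  + exact/cvg_at_right_filter/cF.
  + exact/cvg_at_left_filter/cF.
- by move=> t _; rewrite derive1E; have [_ <-] := dF t.
Qed.

Lemma continuous_wave z : continuous (wave z).
Proof.
move=> t; apply/differentiable_continuous/derivable1_diffP.
by have [] := is_derive_wave z t.
Qed.

Lemma Rintegral01_cos z : \int[lam]_(t in I01) cos (wave z t) = (z == 0)%:R.
Proof.
have [->|z0] := eqVneq z 0.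
  under eq_Rintegral do rewrite /wave mulr0 mul0r cos0.
  by rewrite mean_cst//; exact: lebesgue01.
have w0 : 2 * pi * z%:~R != 0 :> R.
  by rewrite !mulf_neq0 ?intr_eq0// gt_eqF// pi_gt0.
pose F (t : R) := (2 * pi * z%:~R)^-1 * sin (wave z t) : R.
transitivity (F 1 - F 0); last first.
  by rewrite /F /wave mulr1 mulr0 sin0 (sin_cos_2pi_int z).1 !mulr0 subrr.
apply: Rintegral01_FTC => t.
  have := is_deriveZ ((2 * pi * z%:~R)^-1 : R)
    (is_derive1_comp (is_derive_sin (wave z t)) (is_derive_wave z t)).
  by rewrite -[X in is_derive _ _ _ X]/(_ * _) mulrCA mulVf// mulr1.
by apply: continuous_comp; [exact: continuous_wave|exact: continuous_cos].
Qed.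

Lemma Rintegral01_sin z : \int[lam]_(t in I01) sin (wave z t) = 0.
Proof.
have [->|z0] := eqVneq z 0.
  under eq_Rintegral do rewrite /wave mulr0 mul0r sin0.
  by rewrite mean_cst//; exact: lebesgue01.
have w0 : 2 * pi * z%:~R != 0 :> R.
  by rewrite !mulf_neq0 ?intr_eq0// gt_eqF// pi_gt0.
have e (w x : R) : w != 0 -> - w^-1 * (- x * w) = x by move=> ?; field.
pose F (t : R) := - (2 * pi * z%:~R)^-1 * cos (wave z t) : R.
transitivity (F 1 - F 0); last first.
  by rewrite /F /wave mulr1 mulr0 cos0 (sin_cos_2pi_int z).2 !mulr1 subrr.
apply: Rintegral01_FTC => t.
  have := is_deriveZ (- (2 * pi * z%:~R)^-1 : R)
    (is_derive1_comp (is_derive_cos (wave z t)) (is_derive_wave z t)).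
  by rewrite -[X in is_derive _ _ _ X]/(_ * _) e.
by apply: continuous_comp; [exact: continuous_wave|exact: continuous_sin].
Qed.

Lemma waveD z w t : wave (z + w) t = wave z t + wave w t.
Proof. by rewrite /wave intrD; ring. Qed.

Lemma waveB z w t : wave (z - w) t = wave z t - wave w t.
Proof. by rewrite /wave intrB; ring. Qed.

Let mI01 : measurable I01. Proof. by []. Qed.

Let b01 (u : R -> R) : bounded u -> @bounded_mfun _ (measurableTypeR R) R I01 u.
Proof. exact: bounded_mfunS. Qed.

Let mean01 := fun u v (bu : bounded u) (bv : bounded v) =>
  (meanD mI01 (lebesgue01 R) (b01 bu) (b01 bv),
   meanB mI01 (lebesgue01 R) (b01 bu) (b01 bv)).

Lemma bounded_fourier1 j : bounded (fourier1 j).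
Proof.
rewrite /fourier1; case: (j == 1%N); first exact: bounded_mfun_cst.
case: (odd j); apply: bounded_mfunM; try exact: bounded_mfun_cst.
- exact: (bounded_sin_wave j./2).
- exact: (bounded_cos_wave j./2).
Qed.

Lemma fourier1_orthonormal i j : (0 < i)%N -> (0 < j)%N ->
  \int[lam]_(t in I01) (fourier1 i t * fourier1 j t) = (i == j)%:R.
Proof.
have sq2 : Num.sqrt 2 * Num.sqrt 2 = 2 :> R by rewrite -expr2 sqr_sqrtr.
pose C (h : nat) t : R := cos (wave h t); pose S (h : nat) t : R := sin (wave h t).
have bC h : bounded (C h) by exact: bounded_cos_wave.
have bS h : bounded (S h) by exact: bounded_sin_wave.
have ff1 k : fourier1 k = if k == 1%N then fun=> 1 else
    if odd k then (fun t => Num.sqrt 2 * S k./2 t) else (fun t => Num.sqrt 2 * C k./2 t).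
  by apply/funext => t; rewrite /fourier1; do !case: ifP.
have half_gt0 k : (0 < k)%N -> (k == 1%N) = false -> (0 < k./2)%N by case: k => [|[]].
have mZ c u : bounded u -> \int[lam]_(t in I01) (c * u t) = c * \int[lam]_(t in I01) u t.
  by move=> bu; exact: (meanZ mI01 (lebesgue01 R) c (b01 bu)).
have one k : (0 < k)%N -> k != 1%N -> \int[lam]_(t in I01) fourier1 k t = 0.
  move=> k0 k1; rewrite ff1 (negbTE k1); case: ifP => _; rewrite mZ//.
    by rewrite Rintegral01_sin mulr0.
  rewrite Rintegral01_cos -[Posz _ == 0]/(k./2 == 0%N) gtn_eqF ?mulr0//.
  exact/half_gt0/negbTE.
move=> i0 j0.
have [i1|i1] := eqVneq i 1%N.
  under eq_Rintegral do rewrite i1 ff1 /= mul1r.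
  have [j1|j1] := eqVneq j 1%N.
    by rewrite i1 j1 ff1 /= mean_cst//; exact: lebesgue01.
  by rewrite one// i1 eq_sym (negbTE j1).
have [j1|j1] := eqVneq j 1%N.
  under eq_Rintegral do rewrite j1 [fourier1 1 _]/= mulr1.
  by rewrite one// j1 (negbTE i1).
have hi := half_gt0 _ i0 (negbTE i1); have hj := half_gt0 _ j0 (negbTE j1).
set h := i./2 in hi *; set k := j./2 in hj *.
have hk0 : (Posz h + Posz k == 0) = false by rewrite -PoszD eqz_nat addn_eq0 gtn_eqF.
have hkE : (Posz h - Posz k == 0) = (h == k) by rewrite subr_eq0 eqz_nat.
(* An index above one is determined by its frequency and by its parity, which
   distinguishes sines from cosines. *)
have ijE : (i == j) = (h == k) && (odd i == odd j).
  apply/idP/idP => [/eqP ij|/andP[/eqP hk /eqP oij]]; first by rewrite /h /k ij !eqxx.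
  have ei := odd_double_half i; have ej := odd_double_half j.
  by apply/eqP; rewrite -[LHS]ei -[RHS]ej -/h -/k hk oij.
rewrite ijE; under eq_Rintegral do rewrite !ff1 (negbTE i1) (negbTE j1).
case: (odd i); case: (odd j); rewrite ?andbT ?andbF.
- transitivity (\int[lam]_(t in I01)
      (cos (wave (Posz h - Posz k) t) - cos (wave (Posz h + Posz k) t))).
    by apply: eq_Rintegral => t _; rewrite mulrACA sq2 -/h -/k waveB waveD cosB cosD /S; ring.
  rewrite (mean01 (bounded_cos_wave _) (bounded_cos_wave _)) !Rintegral01_cos hk0 hkE.
  by rewrite subr0.
- transitivity (\int[lam]_(t in I01)
      (sin (wave (Posz h + Posz k) t) + sin (wave (Posz h - Posz k) t))).
    by apply: eq_Rintegral => t _; rewrite mulrACA sq2 -/h -/k waveB waveD sinB sinD /S /C; ring.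
  by rewrite (mean01 (bounded_sin_wave _) (bounded_sin_wave _)) !Rintegral01_sin addr0.
- transitivity (\int[lam]_(t in I01)
      (sin (wave (Posz h + Posz k) t) - sin (wave (Posz h - Posz k) t))).
    by apply: eq_Rintegral => t _; rewrite mulrACA sq2 -/h -/k waveB waveD sinB sinD /S /C; ring.
  by rewrite (mean01 (bounded_sin_wave _) (bounded_sin_wave _)) !Rintegral01_sin subr0.
- transitivity (\int[lam]_(t in I01)
      (cos (wave (Posz h + Posz k) t) + cos (wave (Posz h - Posz k) t))).
    by apply: eq_Rintegral => t _; rewrite mulrACA sq2 -/h -/k waveB waveD cosB cosD /C; ring.
  rewrite (mean01 (bounded_cos_wave _) (bounded_cos_wave _)) !Rintegral01_cos hk0 hkE.
  by rewrite add0r.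
Qed.

End fourier_orthonormal.

(** * Trigonometric polynomials in Sobolev balls *)

Section trigonometric_polynomials.
Context (R : realType) (d M : nat).
Local Notation index := {ffun 'I_d -> 'I_M}.
Implicit Types (a b : index -> R).

Lemma bounded_fourier (j : d.-tuple nat) : bounded_mfun setT (@fourier R d j).
Proof.
by apply: (bounded_mfun_tensor (u := fun m => fourier1 (tnth j m))) => m;
  exact: bounded_fourier1.
Qed.

Lemma fourier_orthonormal (i j : d.-tuple nat) : multi_index i -> multi_index j ->
  \int[lebesgue R d]_(x in cube) (fourier i x * fourier j x) = (i == j)%:R.
Proof.
move=> i0 j0.
transitivity (\int[lebesgue R d]_(x in cube)
    \prod_(m < d) (fourier1 (tnth i m) (tnth x m) * fourier1 (tnth j m) (tnth x m))).
  by apply: eq_Rintegral => x _; rewrite -big_split.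
rewrite (Rintegral_tensor
  (u := fun m t => fourier1 (tnth i m) t * fourier1 (tnth j m) t)); last first.
  by move=> m; apply: bounded_mfunM; exact: bounded_fourier1.
under eq_bigr => m _ do rewrite (fourier1_orthonormal R (i0 m) (j0 m)).
have [->|ij] := eqVneq i j; first by under eq_bigr do rewrite eqxx; rewrite big1.
have [m ijm] : exists m, tnth i m != tnth j m.
  apply/existsP; apply: contraNT ij => /existsPn ij; apply/eqP/eq_from_tnth => m.
  by apply/eqP; have := ij m; rewrite negbK.
by rewrite (bigD1 m)//= (negbTE ijm) mul0r.
Qed.

(** Fourier indices start at one. *)
Definition freq (J : index) : d.-tuple nat := [tuple (J m).+1 | m < d].

Lemma multi_index_freq J : multi_index (freq J).
Proof. by move=> m; rewrite tnth_mktuple. Qed.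

Lemma freq_inj : injective freq.
Proof.
move=> J K JK; apply/ffunP => m; apply/val_inj/eq_add_S.
by have := congr1 (fun t => tnth t m) JK; rewrite !tnth_mktuple.
Qed.

Definition trig_poly a (x : euclid R d) : R := \sum_J a J * fourier (freq J) x.

Lemma bounded_trig_poly a : bounded_mfun setT (trig_poly a).
Proof.
apply: bounded_mfun_sum => J; apply: bounded_mfunM; first exact: bounded_mfun_cst.
exact: bounded_fourier.
Qed.

Let mc : measurable (@cube R d) := @measurable_cube R d.
Let c1 := lebesgue_cube R d.

Lemma cube_bounded u : bounded_mfun setT u -> bounded_mfun (@cube R d) (u : _ -> R).
Proof. exact: bounded_mfunS. Qed.

Lemma mean_sum (I : finType) (c : I -> R) (u : I -> euclid R d -> R) :
  (forall i, bounded_mfun setT (u i)) ->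
  \int[lebesgue R d]_(x in cube) (\sum_i c i * u i x) =
  \sum_i c i * \int[lebesgue R d]_(x in cube) u i x.
Proof.
move=> bu; elim: (index_enum I) => [|i r ih].
  by under eq_Rintegral do rewrite big_nil; rewrite (mean_cst mc c1) big_nil.
under eq_Rintegral do rewrite big_cons.
have bcu i' : bounded_mfun setT (fun x => c i' * u i' x).
  by apply: bounded_mfunM => //; exact: bounded_mfun_cst.
rewrite big_cons -ih (meanD mc c1).
- by rewrite (meanZ mc c1)//; exact: cube_bounded.
- exact: cube_bounded.
apply: cube_bounded; elim: r {ih} => [|i' r ih].
  by under [X in bounded_mfun _ X]eq_fun do rewrite big_nil; exact: bounded_mfun_cst.
by under [X in bounded_mfun _ X]eq_fun do rewrite big_cons; exact: bounded_mfunD.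
Qed.

Lemma fourier_coef_trig_poly a j : multi_index j ->
  fourier_coef (trig_poly a) j = \sum_J a J * (freq J == j)%:R.
Proof.
move=> j0; rewrite /fourier_coef.
transitivity (\int[lebesgue R d]_(x in cube) (\sum_J a J * (fourier (freq J) x * fourier j x))).
  apply: eq_Rintegral => x _; rewrite /trig_poly mulr_suml.
  by apply: eq_bigr => J _; rewrite mulrA.
rewrite mean_sum => [|J]; last by apply: bounded_mfunM; exact: bounded_fourier.
by apply: eq_bigr => J _; rewrite fourier_orthonormal//; exact: multi_index_freq.
Qed.

Lemma fourier_coef_freq a J : fourier_coef (trig_poly a) (freq J) = a J.
Proof.
rewrite fourier_coef_trig_poly; last exact: multi_index_freq.
rewrite (bigD1 J)//= eqxx mulr1 big1 ?addr0// => K KJ.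
by rewrite (inj_eq freq_inj) (negbTE KJ) mulr0.
Qed.

Lemma trig_poly_dot a b :
  \int[lebesgue R d]_(x in cube) (trig_poly a x * trig_poly b x) = \sum_J a J * b J.
Proof.
transitivity (\int[lebesgue R d]_(x in cube) (\sum_J b J * (trig_poly a x * fourier (freq J) x))).
  apply: eq_Rintegral => x _; rewrite [X in _ * X]/trig_poly mulr_sumr.
  by apply: eq_bigr => J _; rewrite mulrCA.
rewrite mean_sum => [|J]; last first.
  by apply: bounded_mfunM; [exact: bounded_trig_poly|exact: bounded_fourier].
by apply: eq_bigr => J _; rewrite mulrC; congr (_ * _); exact: fourier_coef_freq.
Qed.

Lemma fourier_coef_trig_poly_sqr a j : multi_index j ->
  fourier_coef (trig_poly a) j ^+ 2 = \sum_J a J ^+ 2 * (freq J == j)%:R.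
Proof.
move=> j0; have [/existsP[J /eqP <-]|/existsPn nj] := boolP [exists J, freq J == j].
  rewrite fourier_coef_freq (bigD1 J)//= eqxx mulr1 big1 ?addr0// => K KJ.
  by rewrite (inj_eq freq_inj) (negbTE KJ) mulr0.
rewrite fourier_coef_trig_poly// !big1 ?expr0n// => J _; first by rewrite (negbTE (nj J)) mulr0.
by rewrite (negbTE (nj J)) mulr0.
Qed.

Definition weight (s : nat) (J : index) : R := \sum_(m < d) (J m).+1%:R ^+ (2 * s).

Lemma weight_ge0 s J : 0 <= weight s J.
Proof. by apply: sumr_ge0 => m _; rewrite exprn_ge0. Qed.

Lemma weight_le s J : weight s J <= d%:R * M%:R ^+ (2 * s).
Proof.
rewrite -[X in X%:R]card_ord -sum1_card natr_sum mulr_suml; apply: ler_sum => m _.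
by rewrite mul1r lerXn2r ?nnegrE// ler_nat.
Qed.

(** Only the frequencies of [a] contribute to the infinite sum: each term is written as
    a sum over [J] of its contribution at [j = freq J], and the sums are
    exchanged. *)
Lemma sobolev_ball_trig_poly a s r :
  \sum_J weight s J * a J ^+ 2 <= r ^+ 2 -> sobolev_ball s%:R r (trig_poly a).
Proof.
move=> ar; split.
  have [mt _] := bounded_trig_poly a; split; first exact: measurable_funTS.
  have b2 := cube_bounded (bounded_mfunX 2 (bounded_trig_poly a)).
  by rewrite -(EFin_mean mc c1 b2) ltry.
apply: le_trans (_ : (\sum_J weight s J * a J ^+ 2)%:E <= _)%E; last by rewrite lee_fin.
rewrite (eq_esum (b := fun j => \sum_J if j \in [set freq J]
    then (weight s J * a J ^+ 2)%:E else 0%E)%E); last first.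
  move=> j j0; rewrite fourier_coef_trig_poly_sqr// mulr_sumr -sumEFin.
  apply: eq_bigr => J _; case: ifPn => [/set_mem ->|jJ].
    rewrite eqxx mulr1; congr (_ * _)%:E; apply: eq_bigr => m _.
    by rewrite tnth_mktuple -natrM powR_mulrn.
  rewrite (negbTE (_ : freq J != j)) ?mulr0//.
  by apply: contra jJ => /eqP <-; rewrite inE.
rewrite esum_sum => [|j J j0 _]; last first.
  by case: ifP => // _; rewrite lee_fin mulr_ge0 ?weight_ge0 ?sqr_ge0.
rewrite -sumEFin; apply: lee_sum => J _.
rewrite -esum_mkcondr (_ : _ `&` _ = [set freq J]).
  by rewrite esum_set1// lee_fin mulr_ge0 ?weight_ge0 ?sqr_ge0.
by apply/seteqP; split => [j []//|j ->]; split => //; exact: multi_index_freq.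
Qed.

End trigonometric_polynomials.

(** * Fejer bumps *)

Section fejer.
Context (R : realType).
Implicit Types (theta x : R).

(** The two expressions of the Fejer kernel.  From [N] to [N + 1] the left-hand side
    gains [1 + 2 \sum_(1 <= i <= N) cos (i theta)], the products with the new terms
    being cosines of differences. *)
Lemma sqr_trig_sums theta (N : nat) :
  (\sum_(j < N) cos (j%:R * theta)) ^+ 2 + (\sum_(j < N) sin (j%:R * theta)) ^+ 2 =
  N%:R + \sum_(i < N.-1) 2 * (N%:R - i.+1%:R) * cos (i.+1%:R * theta).
Proof.
case: N => [|N]; first by rewrite !big_ord0; ring.
elim: N => [|N ih]; first by rewrite !big_ord_recl !big_ord0 mul0r cos0 sin0; ring.
rewrite big_ord_recr [X in _ + X ^+ 2]big_ord_recr /=.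
set c := \sum_(i < N.+1) _; set s := \sum_(i < N.+1) _; rewrite -/c -/s in ih.
have step : cos (N.+1%:R * theta) * c + sin (N.+1%:R * theta) * s =
    \sum_(i < N.+1) cos (i.+1%:R * theta).
  rewrite !mulr_sumr -big_split/= (reindex_inj rev_ord_inj)/=.
  apply: eq_bigr => i _; rewrite -cosB -mulrBl -natrB ?leq_subr//.
  by rewrite subKn.
transitivity ((c ^+ 2 + s ^+ 2) + (cos (N.+1%:R * theta) ^+ 2 + sin (N.+1%:R * theta) ^+ 2)
    + 2 * (cos (N.+1%:R * theta) * c + sin (N.+1%:R * theta) * s)); first by ring.
rewrite ih cos2Dsin2 step mulr_sumr /=.
rewrite [in RHS]big_ord_recr/= [X in _ + X]big_ord_recr/=.
under [X in _ = _ + (X + _)]eq_bigr do rewrite -[N.+2%:R]natr1 addrAC mulrDr mulr1 mulrDl.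
rewrite big_split/= -[N.+2%:R]natr1; ring.
Qed.

(** Multiplying by [2 sin (pi h / N)] makes the sum telescope to a difference of
    sines whose arguments differ by [2 pi h]. *)
Lemma sum_cos_shift theta (N h : nat) : (0 < h < N)%N ->
  \sum_(k < N) cos (theta - 2 * pi * h%:R * (k%:R / N%:R)) = 0.
Proof.
move=> /andP[h0 hN].
have N0 : N%:R != 0 :> R by rewrite pnatr_eq0 -lt0n (leq_trans _ hN).
pose a : R := pi * (h%:R / N%:R).
have a0 : sin a != 0.
  rewrite gt_eqF// sin_gt0_pi// mulr_gt0 ?pi_gt0 ?divr_gt0 ?ltr0n ?(leq_trans _ hN)//=.
  by rewrite gtr_pMr ?pi_gt0// ltr_pdivrMr ?mul1r ?ltr_nat// ltr0n (leq_trans _ hN).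
pose g (k : nat) := sin (theta - 2 * k%:R * a + a).
have tele k : 2 * sin a * cos (theta - 2 * pi * h%:R * (k%:R / N%:R)) = - g k.+1 - - g k.
  rewrite /g (_ : 2 * pi * h%:R * (k%:R / N%:R) = 2 * k%:R * a); last first.
    by rewrite /a; field.
  rewrite (_ : theta - 2 * k.+1%:R * a + a = theta - 2 * k%:R * a - a); last first.
    by rewrite -natr1; ring.
  by move: (theta - 2 * k%:R * a) => u; rewrite sinB sinD; ring.
apply: (@mulfI _ (2 * sin a)); first by rewrite mulf_neq0.
rewrite mulr0 mulr_sumr; under eq_bigr do rewrite tele.
rewrite -(big_mkord xpredT (fun k => - g k.+1 - - g k)).
rewrite (@telescope_sumr _ 0 N (fun k => - g k))//.
rewrite opprK addrC; apply/eqP; rewrite subr_eq0; apply/eqP.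
rewrite /g mulr0 mul0r subr0 (_ : 2 * N%:R * a = (pi *+ 2) *+ h); last first.
  by rewrite /a -[RHS]mulr_natr -[pi *+ 2]mulr_natl; field.
rewrite -[RHS](periodicn (@sinD2pi R) h); congr sin; ring.
Qed.

Variable n : nat.
Local Notation N := n.+1.

(** The coefficient of the bump centred at [k / N] on [fourier1 j.+1]: [j] odd is
    the cosine, and [j] even and positive the sine, of frequency [(j.+1)./2]. *)
Definition bump_coef (k j : nat) : R :=
  if j == 0%N then N%:R^-1
  else Num.sqrt 2 * (N%:R - (j.+1)./2%:R) / N%:R ^+ 2 *
    (if odd j then cos (2 * pi * (j.+1)./2%:R * (k%:R / N%:R))
     else sin (2 * pi * (j.+1)./2%:R * (k%:R / N%:R))).

Definition fejer_bump (k : nat) x : R :=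
  \sum_(j < n.*2.+1) bump_coef k j * fourier1 j.+1 x.

Lemma sum_pairs (F : nat -> R) :
  \sum_(j < n.*2.+1) F j = F 0%N + \sum_(i < n) (F i.*2.+1 + F i.*2.+2).
Proof.
elim: n => [|m ih]; first by rewrite big_ord_recl !big_ord0.
by rewrite doubleS 2!big_ord_recr/= ih [in RHS]big_ord_recr/= !addrA.
Qed.

Let N0 : N%:R != 0 :> R. Proof. by []. Qed.

Let sq2 : Num.sqrt 2 * Num.sqrt 2 = 2 :> R.
Proof. by rewrite -expr2 sqr_sqrtr. Qed.

(** The sum of a cosine and a sine of the same frequency is a translated cosine. *)
Lemma bump_cosE k x : fejer_bump k x =
  N%:R^-1 + \sum_(i < n) 2 * (N%:R - i.+1%:R) / N%:R ^+ 2 *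
     cos (2 * pi * i.+1%:R * x - 2 * pi * i.+1%:R * (k%:R / N%:R)).
Proof.
rewrite /fejer_bump (sum_pairs (fun j => bump_coef k j * fourier1 j.+1 x)).
rewrite {1}/bump_coef /fourier1 /= mulr1; congr (_ + _); apply: eq_bigr => i _.
rewrite /bump_coef /= odd_double /= uphalf_double doubleK.
move: (2 * pi * _ * x) (2 * pi * _ * (k%:R / _)) => u v.
rewrite cosB; transitivity (Num.sqrt 2 * Num.sqrt 2 * (N%:R - i.+1%:R) / N%:R ^+ 2 *
  (cos u * cos v + sin u * sin v) : R); first by ring.
by rewrite sq2.
Qed.

Lemma bump_sqrE k x : fejer_bump k x =
  ((\sum_(j < N) cos (j%:R * (2 * pi * (x - k%:R / N%:R)))) ^+ 2 +
   (\sum_(j < N) sin (j%:R * (2 * pi * (x - k%:R / N%:R)))) ^+ 2) / N%:R ^+ 2.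
Proof.
rewrite sqr_trig_sums bump_cosE [RHS]mulrDl; congr (_ + _).
  by rewrite expr2 invfM mulrA mulfV// mul1r.
rewrite mulr_suml; apply: eq_bigr => i _; rewrite mulrAC; congr (_ * _ * cos _ * _).
by ring.
Qed.

Lemma bump_ge0 k x : 0 <= fejer_bump k x.
Proof. by rewrite bump_sqrE divr_ge0// ?addr_ge0 ?sqr_ge0. Qed.

Lemma sum_bump x : \sum_(k < N) fejer_bump k x = 1.
Proof.
under eq_bigr do rewrite bump_cosE.
rewrite big_split/= sumr_const card_ord -[X in X + _]mulr_natr mulVf// exchange_big/=.
rewrite big1 ?addr0// => i _; rewrite -mulr_sumr sum_cos_shift ?mulr0//.
exact: ltn_ord.
Qed.

(** The sum of squares is [1 / N^2 + 2 \sum_(i <= n) i^2 / N^4], that is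
    [(2 N^2 + 1) / (3 N^3)]. *)
Lemma sum_bump_coef_sqr k : 2 / 3 / N%:R <= \sum_(j < n.*2.+1) bump_coef k j ^+ 2.
Proof.
rewrite (sum_pairs (fun j => bump_coef k j ^+ 2)) {1}/bump_coef /=.
have E (i : 'I_n) : bump_coef k i.*2.+1 ^+ 2 + bump_coef k i.*2.+2 ^+ 2 =
    2 / N%:R ^+ 4 * (n - i)%:R ^+ 2.
  rewrite /bump_coef /= odd_double /= uphalf_double doubleK.
  have -> : (n - i)%:R = N%:R - i.+1%:R :> R.
    by rewrite -[(n - i)%N]subSS natrB// ltnS (ltnW (ltn_ord i)).
  move: (2 * pi * _ * _) => v.
  transitivity (Num.sqrt 2 * Num.sqrt 2 / N%:R ^+ 4 * (N%:R - i.+1%:R) ^+ 2 *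
    (cos v ^+ 2 + sin v ^+ 2) : R); first by field.
  by rewrite sq2 cos2Dsin2 mulr1.
under eq_bigr do rewrite E.
rewrite -mulr_sumr (reindex_inj rev_ord_inj)/=.
have sqr_sum m : 6 * \sum_(i < m) i.+1%:R ^+ 2 = m%:R * (m%:R + 1) * (2 * m%:R + 1) :> R.
  elim: m => [|m ih]; first by rewrite big_ord0 mulr0 !mul0r.
  by rewrite big_ord_recr/= mulrDr ih -natr1; ring.
under eq_bigr => i _ do rewrite subKn//.
have -> : \sum_(i < n) i.+1%:R ^+ 2 = n%:R * (n%:R + 1) * (2 * n%:R + 1) / 6 :> R.
  by rewrite -sqr_sum mulrC mulKf.
have NE : N%:R = n%:R + 1 :> R by rewrite natr1.
rewrite NE -subr_ge0.
have n1 : n%:R + 1 != 0 :> R by rewrite natr1.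
rewrite (_ : _ - _ = 3^-1 * (n%:R + 1)^-1 ^+ 3); last by field.
by rewrite mulr_ge0// exprn_ge0// invr_ge0 addr_ge0.
Qed.

End fejer.

(** * Tensor bumps and perturbed densities *)

Section tensor_bumps.
Context (R : realType) (d n : nat).
Local Notation N := n.+1.
Local Notation M := (n.*2.+1).
Local Notation index := {ffun 'I_d -> 'I_M}.
Local Notation node := {ffun 'I_d -> 'I_N}.
Local Notation mu := (lebesgue R d).
Implicit Types (s : node -> R) (K : node) (J : index) (x : euclid R d).

Definition tensor_coef K J : R := \prod_(m < d) bump_coef R n (K m) (J m).

Definition tensor_bump K : euclid R d -> R := trig_poly (tensor_coef K).

Lemma tensor_bumpE K x : tensor_bump K x = \prod_(m < d) fejer_bump n (K m) (tnth x m).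
Proof.
rewrite /fejer_bump bigA_distr_bigA /=; apply: eq_bigr => J _.
rewrite -big_split/=; apply: eq_bigr => m _.
by rewrite tnth_mktuple.
Qed.

Lemma tensor_bump_ge0 K x : 0 <= tensor_bump K x.
Proof. by rewrite tensor_bumpE; apply: prodr_ge0 => m _; exact: bump_ge0. Qed.

Lemma sum_tensor_bump x : \sum_K tensor_bump K x = 1.
Proof.
under eq_bigr do rewrite tensor_bumpE.
rewrite -(bigA_distr_bigA (fun (m : 'I_d) (k : 'I_N) => fejer_bump n k (tnth x m))) /=.
by rewrite big1// => m _; exact: sum_bump.
Qed.

Definition index0 : index := [ffun=> ord0].

Lemma fourier_index0 x : fourier (freq index0) x = 1.
Proof. by rewrite /fourier big1// => m _; rewrite tnth_mktuple ffunE. Qed.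

Lemma mean_trig_poly (a : index -> R) : \int[mu]_(x in cube) trig_poly a x = a index0.
Proof.
rewrite -[RHS]fourier_coef_freq; apply: eq_Rintegral => x _.
by rewrite fourier_index0 mulr1.
Qed.

(** The integral of each bump. *)
Definition mass : R := N%:R^-1 ^+ d.

Lemma card_node_mass : #|{: node}|%:R * mass = 1.
Proof.
by rewrite card_ffun !card_ord natrX /mass -exprMn mulfV ?pnatr_eq0// expr1n.
Qed.

Lemma tensor_coef0 K : tensor_coef K index0 = mass.
Proof.
rewrite /tensor_coef; under eq_bigr do rewrite ffunE.
by rewrite prodr_const card_ord.
Qed.

(** By Parseval, the mean square is the product over the coordinates of the sums of
    squares of the one-dimensional coefficients. *)
Lemma tensor_bump_sqr_ge K :
  (2 / 3) ^+ d * mass <= \int[mu]_(x in cube) (tensor_bump K x * tensor_bump K x).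
Proof.
rewrite trig_poly_dot.
under eq_bigr do rewrite -expr2 /tensor_coef -prodrXl.
rewrite -(bigA_distr_bigA (fun m (j : 'I_M) => bump_coef R n (K m) j ^+ 2)).
rewrite /mass -exprMn -[X in _ ^+ X]card_ord -prodr_const.
apply: ler_prod => m _; rewrite sum_bump_coef_sqr andbT.
by rewrite mulr_ge0 ?invr_ge0// divr_ge0.
Qed.

Definition comb_coef s J : R := \sum_K s K * tensor_coef K J.

Lemma trig_polyZ c (a : index -> R) x : trig_poly (fun J => c * a J) x = c * trig_poly a x.
Proof. by rewrite /trig_poly mulr_sumr; apply: eq_bigr => J _; rewrite mulrA. Qed.

Lemma comb_bump s x : trig_poly (comb_coef s) x = \sum_K s K * tensor_bump K x.
Proof.
rewrite /trig_poly /comb_coef; under eq_bigr do rewrite mulr_suml.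
rewrite exchange_big; apply: eq_bigr => K _ /=.
by rewrite mulr_sumr; apply: eq_bigr => J _; rewrite mulrA.
Qed.

(** The bumps form a partition of unity. *)
Lemma comb_bump_le1 s x : (forall K, `|s K| <= 1) -> `|trig_poly (comb_coef s) x| <= 1.
Proof.
move=> s1; rewrite comb_bump -(sum_tensor_bump x).
apply: le_trans (ler_norm_sum _ _ _) _; apply: ler_sum => K _.
by rewrite normrM (ger0_norm (tensor_bump_ge0 _ _)) ler_piMl// tensor_bump_ge0.
Qed.

Let mc : measurable (@cube R d) := @measurable_cube R d.
Let c1 := lebesgue_cube R d.

(** Parseval turns the uniform bound into a bound on the coefficients. *)
Lemma comb_coef_sqr_le1 s : (forall K, `|s K| <= 1) -> \sum_J comb_coef s J ^+ 2 <= 1.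
Proof.
move=> s1; under eq_bigr do rewrite expr2; rewrite -trig_poly_dot -[leRHS](mean_cst mc c1).
have b := @bounded_trig_poly R d M (comb_coef s).
apply: (le_mean mc c1).
- by apply: cube_bounded; exact: bounded_mfunM.
- exact: bounded_mfun_cst.
move=> x _; rewrite -expr2 -real_normK ?num_real// expr_le1//.
exact: comb_bump_le1.
Qed.

Lemma comb_coef0_le1 s : (forall K, `|s K| <= 1) -> `|comb_coef s index0| <= 1.
Proof.
move=> s1; rewrite -mean_trig_poly; apply: (mean_norm_le mc c1).
- by apply: cube_bounded; exact: bounded_trig_poly.
- by move=> x _; exact: comb_bump_le1.
Qed.

Lemma sobolev_comb s c sigma r : (forall K, `|s K| <= 1) ->
  c ^+ 2 * (d%:R * M%:R ^+ (2 * sigma)) <= r ^+ 2 ->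
  sobolev_ball sigma%:R r (trig_poly (fun J => c * comb_coef s J)).
Proof.
move=> s1 cr; apply: sobolev_ball_trig_poly; apply: le_trans cr.
have W : 0 <= d%:R * M%:R ^+ (2 * sigma) :> R by rewrite mulr_ge0 ?exprn_ge0.
rewrite -[leRHS]mulr1; apply: le_trans (ler_wpM2l _ (comb_coef_sqr_le1 s1)); last first.
  by rewrite mulr_ge0 ?sqr_ge0.
rewrite mulr_sumr; apply: ler_sum => J _.
rewrite exprMn mulrCA -[leRHS]mulrA ler_wpM2l ?sqr_ge0// ler_wpM2r ?sqr_ge0//.
exact: weight_le.
Qed.

Section perturbed_density.
Variable gam : R.
Hypothesis gam0 : 0 <= gam.
Hypothesis gam_half : gam <= 2^-1.
Variable s : node -> R.
Hypothesis s1 : forall K, `|s K| <= 1.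

(** Fixing the constant coefficient to one makes the total mass one. *)
Definition density_coef J : R := if J == index0 then 1 else gam * comb_coef s J.

Lemma density_polyE x : trig_poly density_coef x =
  1 + gam * (\sum_K s K * (tensor_bump K x - mass)).
Proof.
transitivity (1 + gam * (trig_poly (comb_coef s) x - comb_coef s index0)).
  rewrite /trig_poly (bigD1 index0)//= [in RHS](bigD1 index0)//= /density_coef.
  rewrite eqxx fourier_index0 !mulr1; congr (_ + _).
  rewrite addrAC subrr add0r mulr_sumr; apply: eq_bigr => J /negbTE ->.
  by rewrite mulrA.
congr (_ + _ * _); rewrite comb_bump /comb_coef -sumrB; apply: eq_bigr => K _.
by rewrite tensor_coef0 mulrBr.
Qed.

Lemma density_poly_ge0 x : cube x -> 0 <= trig_poly density_coef x.
Proof.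
move=> _; rewrite density_polyE; under eq_bigr do rewrite mulrBr.
rewrite sumrB -comb_bump.
have -> : \sum_K s K * mass = comb_coef s index0.
  by apply: eq_bigr => K _; rewrite tensor_coef0.
have := comb_bump_le1 x s1; have := comb_coef0_le1 s1.
rewrite !ler_norml => /andP[h1 h2] /andP[h3 h4].
have := gam0; have := gam_half; nra.
Qed.

Lemma density_poly_mass : (\int[mu]_(x in cube) (trig_poly density_coef x)%:E = 1)%E.
Proof.
have b := cube_bounded (bounded_trig_poly density_coef).
by rewrite -(EFin_mean mc c1 b) mean_trig_poly /density_coef eqxx.
Qed.

Definition perturbed : density R d :=
  Density (cube_bounded (bounded_trig_poly density_coef)).1 density_poly_ge0 density_poly_mass.

Lemma sobolev_perturbed sigma r :
  d%:R + gam ^+ 2 * (d%:R * M%:R ^+ (2 * sigma)) <= r ^+ 2 ->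
  sobolev_ball sigma%:R r perturbed.
Proof.
move=> gr; apply: sobolev_ball_trig_poly; apply: le_trans gr.
rewrite (bigD1 index0)//= {1}/density_coef eqxx expr1n mulr1; apply: lerD.
  rewrite /weight; under eq_bigr do rewrite ffunE expr1n.
  by rewrite sumr_const card_ord.
have W : 0 <= d%:R * M%:R ^+ (2 * sigma) :> R by rewrite mulr_ge0 ?exprn_ge0.
rewrite -[leRHS]mulr1; apply: le_trans (ler_wpM2l _ (comb_coef_sqr_le1 s1)); last first.
  by rewrite mulr_ge0 ?sqr_ge0.
rewrite mulr_sumr [leRHS](bigD1 index0)//= -[leLHS]add0r lerD//.
  by rewrite mulr_ge0 ?sqr_ge0// mulr_ge0// sqr_ge0.
apply: ler_sum => J /negbTE J0; rewrite /density_coef J0.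
rewrite exprMn mulrCA -[leRHS]mulrA ler_wpM2l ?sqr_ge0// ler_wpM2r ?sqr_ge0//.
exact: weight_le.
Qed.

End perturbed_density.
End tensor_bumps.

(** * Two auxiliary lemmas on averages *)

Section nonmeasurable.
Import HBNNSimple.

(** The loss is a supremum over an uncountable class and may fail to be measurable; the
    integral of a nonnegative function is a supremum over simple functions, and
    is monotone in any case. *)
Lemma ge0_le_integral_nonmeasurable (dT : measure_display) (T : measurableType dT)
  (R : realType) (mu : {measure set T -> \bar R}) (f g : T -> \bar R) :
  (forall x, 0 <= f x)%E -> (forall x, f x <= g x)%E ->
  (\int[mu]_x f x <= \int[mu]_x g x)%E.
Proof.
move=> f0 fg; have g0 x : (0 <= g x)%E by exact: le_trans (f0 x) (fg x).
rewrite !ge0_integralE//; apply: ge_ereal_sup => _ [h hf <-]; apply: ereal_sup_ubound.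
exists h => // x; apply: le_trans (hf x) _; rewrite !patch_setT; exact: fg.
Qed.

End nonmeasurable.

(** For a fixed coordinate [i], the involution [flip i] pairs the vertices, so the average
    over all vertices of [S e i] is at least [c / 2]. *)
Lemma pairing_average (R : realFieldType) (E I : finType) (flip : I -> E -> E)
  (S : E -> I -> R) (c : R) :
  (forall i, involutive (flip i)) -> (forall e i, c <= S e i + S (flip i e) i) -> E ->
  exists e, #|I|%:R * c / 2 <= \sum_i S e i.
Proof.
move=> flipK Sc e0; apply/existsP; apply: contraT => /existsPn lt_e.
have : \sum_e \sum_i S e i < \sum_(e : E) (#|I|%:R * c / 2).
  apply: ltr_sum => [|e _]; last by rewrite ltNge lt_e.
  by apply/hasP; exists e0 => //; rewrite mem_index_enum.
rewrite exchange_big/= ltNge => /negP[].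
have half i : #|E|%:R * c / 2 <= \sum_e S e i.
  rewrite ler_pdivrMr// mulr_natr mulr2n {2}(reindex_inj (inv_inj (flipK i))) -big_split/=.
  by rewrite mulr_natl -sumr_const; apply: ler_sum => e _; exact: Sc.
apply: (@le_trans _ _ (#|I|%:R * (#|E|%:R * c / 2))); last first.
  by rewrite mulr_natl -sumr_const; apply: ler_sum => i _; exact: half.
have -> : \sum_(e : E) (#|I|%:R * c / 2) = #|E|%:R * (#|I|%:R * c / 2).
  by rewrite sumr_const [RHS]mulr_natl.
by rewrite -!mulrA mulrCA.
Qed.

(** * A private version of Assouad's lemma *)

Lemma min1D_ge1 (R : realDomainType) (u v : R) :
  0 <= u -> 0 <= v -> 1 <= u + v -> 1 <= Num.min u 1 + Num.min v 1.
Proof. by move=> u0 v0 uv; rewrite !minEle; do 2 case: ifP => _; lra. Qed.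

Section private_assouad.
Context (R : realType) (d p n beta delta : nat) (dZ : measure_display)
  (Z : measurableType dZ).
Variables (Q : mechanism R d n Z) (alpha r gam kap : R).
Local Notation node := {ffun 'I_d -> 'I_p.+1}.
Local Notation M := (p.*2.+1).
Local Notation mu := (lebesgue R d).
Local Notation mass := (mass R d p).
Local Notation vertex := {ffun node -> bool}.
Local Notation Phi := (@tensor_bump R d p).
Local Notation G := (@sobolev_ball R d delta%:R 1).
Implicit Types (e : vertex) (K : node).

Hypothesis alpha0 : 0 < alpha.
Hypothesis Qalpha : ldp alpha Q.
Hypothesis gam0 : 0 < gam.
Hypothesis gam_half : gam <= 2^-1.
Hypothesis gam_smooth : d%:R + gam ^+ 2 * (d%:R * M%:R ^+ (2 * beta)) <= r ^+ 2.
Hypothesis gam_private : n%:R * ((expR alpha - 1) * (4 * gam * mass)) ^+ 2 <= 2^-1.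
Hypothesis mass_small : 2 * mass <= (2 / 3) ^+ d.
Hypothesis kap0 : 0 < kap.
Hypothesis kap_smooth : kap ^+ 2 * (d%:R * M%:R ^+ (2 * delta)) <= 1.

Variable ft : n.-tuple Z -> euclid R d -> R.
Hypothesis ft_est : estimator G ft.

Let mc : measurable (@cube R d) := @measurable_cube R d.
Let c1 := lebesgue_cube R d.

Let sign e K : R := (-1) ^+ e K.

Let sign1 e K : `|sign e K| <= 1.
Proof. by rewrite normrX normrN1 expr1n. Qed.

Let fe e : density R d := perturbed (ltW gam0) gam_half (sign1 e).

Let flip K e : vertex := [ffun L => if L == K then ~~ e L else e L].

Let flipK K : involutive (flip K).
Proof. by move=> e; apply/ffunP => L; rewrite !ffunE; case: eqP; rewrite ?negbK. Qed.

Let sign_flip e K : sign (flip K e) K = - sign e K.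
Proof. by rewrite /sign ffunE eqxx signrN. Qed.

Let sign_norm e K : `|sign e K| = 1.
Proof. by rewrite normrX normrN1 expr1n. Qed.

Let bPhi K : bounded_mfun setT (Phi K). Proof. exact: bounded_trig_poly. Qed.

Let mass_ge0 : 0 <= mass. Proof. by rewrite exprn_ge0. Qed.

Let mean_Phi K : \int[mu]_(x in cube) Phi K x = mass.
Proof. by rewrite mean_trig_poly tensor_coef0. Qed.

Let fe_diff e K x : fe (flip K e) x - fe e x = - 2 * gam * sign e K * (Phi K x - mass).
Proof.
rewrite /= !density_polyE opprD addrACA subrr add0r -mulrBr -sumrB.
rewrite (bigD1 K)//= sign_flip big1 => [|L /negbTE LK]; first by ring.
by rewrite /sign ffunE LK subrr.
Qed.

Let bfe e : bounded_mfun setT (fe e). Proof. exact: bounded_trig_poly. Qed.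

(** The bump and the constant [mass] have the same integral, so that their difference has
    L1 norm at most [2 mass]. *)
Let l1_flip e K : \int[mu]_(x in cube) `|fe (flip K e) x - fe e x| <= 4 * gam * mass.
Proof.
have bm : bounded_mfun cube (fun _ : euclid R d => mass) by exact: bounded_mfun_cst.
have bP := cube_bounded (bPhi K).
have -> : 4 * gam * mass = \int[mu]_(x in cube) (2 * gam * (Phi K x + mass)).
  rewrite (meanZ mc c1) ?(meanD mc c1)//; last exact: bounded_mfunD.
  by rewrite mean_Phi (mean_cst mc c1); ring.
apply: (le_mean mc c1).
- by apply: bounded_mfun_norm; apply: cube_bounded; apply: bounded_mfunB; exact: bfe.
- by apply: bounded_mfunM; [exact: bounded_mfun_cst|exact: bounded_mfunD].
move=> x _; rewrite fe_diff normrM normrM sign_norm mulr1 mulNr normrN.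
rewrite (ger0_norm (_ : 0 <= 2 * gam)) ?mulr_ge0 ?(ltW gam0)//.
rewrite ler_wpM2l ?mulr_ge0 ?(ltW gam0)//.
have := tensor_bump_ge0 K x; have := mass_ge0; rewrite ler_norml; lra.
Qed.

Let target e K : R := \int[mu]_(x in cube) (fe e x * Phi K x).

Let gap : R := gam * (2 / 3) ^+ d * mass.

Let gap_gt0 : 0 < gap.
Proof. by rewrite !mulr_gt0// exprn_gt0 ?divr_gt0 ?invr_gt0. Qed.

(** The two targets differ by [2 gam] times the variance of [Phi K], whose mean
    square is at least [(2 / 3)^d mass], hence at least twice the square of its
    mean. *)
Let target_gap e K : gap <= `|target (flip K e) K - target e K|.
Proof.
have bP := cube_bounded (bPhi K).
have bf e' : bounded_mfun cube (fun x => fe e' x * Phi K x).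
  by apply: cube_bounded; apply: bounded_mfunM; [exact: bfe|exact: bPhi].
have bPP : bounded_mfun cube (fun x => Phi K x * Phi K x) by exact: bounded_mfunM.
rewrite /target -(meanB mc c1)//.
have -> : \int[mu]_(x in cube) (fe (flip K e) x * Phi K x - fe e x * Phi K x) =
    - 2 * gam * sign e K * (\int[mu]_(x in cube) (Phi K x * Phi K x) - mass * mass).
  have -> : mass * mass = mass * \int[mu]_(x in cube) Phi K x by rewrite mean_Phi.
  rewrite -(meanZ mc c1)// -(meanB mc c1)//; last first.
    by apply: bounded_mfunM => //; exact: bounded_mfun_cst.
  rewrite -(meanZ mc c1); last first.
    apply: bounded_mfunB => //.
    by apply: bounded_mfunM => //; exact: bounded_mfun_cst.
  apply: eq_Rintegral => x _; rewrite -mulrBl fe_diff; ring.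
rewrite !normrM sign_norm mulr1 normrN normr_nat (gtr0_norm gam0).
have := tensor_bump_sqr_ge R K; set I := \int[mu]_(x in cube) _ => hI.
have h2 : mass * (2 * mass) <= mass * (2 / 3) ^+ d by rewrite ler_wpM2l.
have h3 : (2 / 3) ^+ d * mass <= 2 * `|I - mass * mass|.
  by have := ler_norm (I - mass * mass); lra.
by rewrite /gap -!mulrA [leRHS]mulrCA ler_wpM2l ?(ltW gam0).
Qed.

(** The dual functions at which the loss is evaluated. *)
Let witness (s : node -> R) : euclid R d -> R := trig_poly (fun J => kap * comb_coef s J).

Let witnessE s x : witness s x = kap * \sum_K s K * Phi K x.
Proof. by rewrite /witness trig_polyZ comb_bump. Qed.

Let witness_G s : (forall K, `|s K| <= 1) -> G (witness s).
Proof. by move=> s1; apply: sobolev_comb; rewrite // expr1n. Qed.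

(** A multiple of a single bump is one of the dual functions. *)
Let ft_integrable z K : mu.-integrable cube (fun x => (ft z x * Phi K x)%:E).
Proof.
pose s (L : node) : R := (L == K)%:R.
have s1 L : `|s L| <= 1 by rewrite /s; case: (L == K); rewrite ?normr1 ?normr0.
have := integrableZl mc (kap^-1) (ft_est.2 z _ (witness_G s1)).
apply: eq_integrable => // x _; rewrite -EFinM witnessE; congr _%:E.
rewrite (bigD1 K)//= big1 => [|L /negbTE LK]; last by rewrite /s LK mul0r.
rewrite /s eqxx addr0 mul1r.
by have kapN0 : kap != 0 by [rewrite gt_eqF]; field.
Qed.

Let stat K z : R := \int[mu]_(x in cube) (ft z x * Phi K x).

(** Tonelli applied to the positive and negative parts. *)
Let measurable_stat K : measurable_fun setT (stat K).
Proof.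
pose D : set (n.-tuple Z * euclid R d) := [set zx | cube zx.2].
have mD : measurable D.
  rewrite (_ : D = setT `*` cube); first exact: measurableX.
  by apply/seteqP; split => [[z x] cx|[z x] [_ cx]].
pose F (zx : n.-tuple Z * euclid R d) : \bar R := (ft zx.1 zx.2 * Phi K zx.2)%:E.
have mF : measurable_fun setT (F \_ D).
  apply/(measurable_restrictT _ _).1 => //; apply/measurable_EFinP.
  apply: measurable_funM; first exact: ft_est.1.
  apply: measurable_funTS; exact: (measurableT_comp (bPhi K).1 measurable_snd).
apply: measurableT_comp => //.
rewrite (_ : (fun z => _) = (fun z =>
    \int[mu]_x (F \_ D)^\+ (z, x) - \int[mu]_x (F \_ D)^\- (z, x))%E).
  apply: emeasurable_funB.
  - by apply: measurable_fun_fubini_tonelli_F => //; exact: measurable_funepos.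
  - by apply: measurable_fun_fubini_tonelli_F => //; exact: measurable_funeneg.
apply/funext => z; rewrite integral_mkcond.
rewrite (_ : _ \_ cube = (F \_ D) \o pair z); last first.
  apply/funext => x; have zx : ((z, x) \in D) = (x \in cube).
    by apply/idP/idP => /set_mem h; apply/mem_set.
  by rewrite /= !patchE zx.
rewrite integralE; congr (_ - _)%E; apply: eq_integral => x _.
  by rewrite funepos_comp.
by rewrite funeneg_comp.
Qed.

(** The signs of [stat K z - target e K] are the best choice of coefficients. *)
Let loss_ge e z :
  ((kap * \sum_K `|stat K z - target e K|)%:E <= adversarial_loss G (ft z) (fe e))%E.
Proof.
pose s K := Num.sg (stat K z - target e K).
have s1 K : `|s K| <= 1 by rewrite normr_sg; case: (_ != 0).
apply: le_trans (ereal_sup_ubound _); last by exists (witness s) => //; exact: witness_G.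
have bf K : bounded_mfun cube (fun x => fe e x * Phi K x).
  by apply: cube_bounded; apply: bounded_mfunM; [exact: bfe|exact: bPhi].
have if1 K : mu.-integrable cube (EFin \o (fun x => fe e x * Phi K x)).
  have cubeoo : (mu cube < +oo)%E by rewrite c1 ltry.
  exact: (bounded_mfun_integrable mc cubeoo (bf K)).
have i1 K : mu.-integrable cube (fun x => (kap * s K)%:E *
    ((ft z x * Phi K x)%:E - (fe e x * Phi K x)%:E))%E.
  apply: integrableZl => //; apply: integrableB => //; exact: if1.
have -> : (\int[mu]_(x in cube) ((ft z x - fe e x) * witness s x)%:E =
    \int[mu]_(x in cube) (\sum_K (kap * s K)%:E *
    ((ft z x * Phi K x)%:E - (fe e x * Phi K x)%:E)))%E.
  apply: eq_integral => x _; rewrite witnessE !mulr_sumr -sumEFin.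
  apply: eq_bigr => K _; rewrite -EFinB -EFinM; congr _%:E; ring.
rewrite integral_sum// mulr_sumr -sumEFin; apply: lee_sum => K _.
rewrite integralZl//; last by apply: integrableB => //; exact: if1.
rewrite integralB//; last exact: if1.
have -> : (\int[mu]_(x in cube) (ft z x * Phi K x)%:E = (stat K z)%:E)%E.
  by rewrite fineK// integrable_fin_num.
have -> : (\int[mu]_(x in cube) (fe e x * Phi K x)%:E = (target e K)%:E)%E.
  by rewrite fineK//; apply: integrable_fin_num => //; exact: if1.
by rewrite -EFinB -EFinM lee_fin -mulrA -normrEsg.
Qed.

(** Truncation at the gap turns the distance to the target into a test function. *)
Let test e K z : R := Num.min (`|stat K z - target e K| / gap) 1.

Let is_test_test e K : is_test (test e K).
Proof.
split.
  apply: measurable_minr; last exact: measurable_cst.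
  apply: measurable_funM; last exact: measurable_cst.
  apply: measurableT_comp => //; apply: measurable_funB; last exact: measurable_cst.
  exact: measurable_stat.
move=> z; rewrite /test le_min ler01 ge_min lexx orbT andbT.
by rewrite divr_ge0// ltW.
Qed.

Let test_flip e K z : 1 <= test e K z + test (flip K e) K z.
Proof.
have := target_gap e K; rewrite /test.
set a := stat K z; set t := target e K; set t' := target _ _ => tt'.
have h : 1 <= `|a - t| / gap + `|a - t'| / gap.
  rewrite -mulrDl ler_pdivlMr// mul1r; apply: le_trans tt' _.
  rewrite (_ : t' - t = (a - t) - (a - t')); last by ring.
  exact: ler_normB.
have h1 : 0 <= `|a - t| / gap by rewrite divr_ge0// ltW.
have h2 : 0 <= `|a - t'| / gap by rewrite divr_ge0// ltW.
exact: min1D_ge1.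
Qed.

Let mean_test e K : R := \int[joint_law Q (fe e) (leqnn n)]_w test e K (map_tuple snd w).

Let mean_test_flip e K : 2^-1 <= mean_test e K + mean_test (flip K e) K.
Proof.
apply: (transcript_overlap alpha0 Qalpha (l1_flip e K) gam_private).
- exact: is_test_test.
- exact: is_test_test.
- exact: test_flip.
Qed.

Let risk_ge e : ((kap * gap * \sum_K mean_test e K)%:E <= risk G Q ft (fe e))%E.
Proof.
have P1 : joint_law Q (fe e) (leqnn n) setT = 1%E by exact: probability_setT.
have bt K : bounded_mfun setT (fun w : n.-tuple (euclid R d * Z) => test e K (map_tuple snd w)).
  apply: test_bounded; have [mt t01] := is_test_test e K; split => //.
  exact: measurableT_comp mt (@measurable_map_snd _ _ (euclid R d) Z n).
have bs : bounded_mfun setT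
    (fun w : n.-tuple (euclid R d * Z) => \sum_K test e K (map_tuple snd w)).
  exact: bounded_mfun_sum.
have -> : \sum_K mean_test e K =
    \int[joint_law Q (fe e) (leqnn n)]_w (\sum_K test e K (map_tuple snd w)).
  rewrite /mean_test; elim: (index_enum _) => [|K l ih].
    by under eq_Rintegral do rewrite big_nil; rewrite big_nil (mean_cst measurableT P1).
  under eq_Rintegral do rewrite big_cons.
  rewrite big_cons ih (meanD measurableT P1)//.
  elim: l {ih} => [|K' l ih].
    by under [X in bounded_mfun _ X]eq_fun do rewrite big_nil; exact: bounded_mfun_cst.
  by under [X in bounded_mfun _ X]eq_fun do rewrite big_cons; exact: bounded_mfunD.
rewrite -(meanZ measurableT P1)// (EFin_mean measurableT P1); last first.
  by apply: bounded_mfunM => //; exact: bounded_mfun_cst.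
apply: ge0_le_integral_nonmeasurable => w.
  rewrite lee_fin mulr_ge0 ?(mulr_ge0 (ltW kap0) (ltW gap_gt0))//.
  by apply: sumr_ge0 => K _; have [_ /(_ (map_tuple snd w))/andP[]] := is_test_test e K.
apply: le_trans (loss_ge e (map_tuple snd w)); rewrite lee_fin -mulrA ler_wpM2l ?(ltW kap0)//.
rewrite mulr_sumr; apply: ler_sum => K _.
by rewrite mulrC -ler_pdivlMr// /test ge_min lexx.
Qed.

(** Each of the [N^d] coordinates contributes [gap / 4] on average, and [gap] is of
    order [gam N^-d]. *)
Lemma private_assouad :
  ((kap * gam * (2 / 3) ^+ d / 4)%:E <=
   ereal_sup [set risk G Q ft f | f in [set f : density R d | sobolev_ball beta%:R r f]])%E.
Proof.
have [e he] := pairing_average flipK mean_test_flip [ffun=> false].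
apply: le_trans (ereal_sup_ubound _); last first.
  by exists (fe e) => //; exact: (sobolev_perturbed _ _ _ gam_smooth).
apply: le_trans (risk_ge e); rewrite lee_fin.
have nodes := card_node_mass R d p.
have kg0 : 0 <= kap * gap by rewrite mulr_ge0 ?(ltW kap0) ?(ltW gap_gt0).
apply: le_trans (ler_wpM2l kg0 he).
rewrite /gap; move: nodes; set m := mass; set c := #|_|%:R => nodes.
have -> : kap * (gam * (2 / 3) ^+ d * m) * (c * 2^-1 / 2) =
   (c * m) * (kap * gam * (2 / 3) ^+ d / 4) by field.
by rewrite nodes mul1r.
Qed.

End private_assouad.

(** * Choice of the parameters *)

Section rates.
Context (R : realType).

(** From [exp (- a) >= 1 - a]. *)
Lemma expRB1_le (A a : R) : 0 <= a -> a <= A -> expR a - 1 <= a * expR A.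
Proof.
move=> a0 aA; apply: (@le_trans _ _ (a * expR a)); last by rewrite ler_wpM2l// ler_expR.
have := expR_ge1Dx (- a); rewrite expRN => h.
have : expR a * (1 - a) <= expR a * (expR a)^-1 by rewrite ler_wpM2l ?expR_ge0.
rewrite mulfV ?gt_eqF ?expR_gt0//; lra.
Qed.

Variables (d beta delta : nat) (A r c0 : R).
Hypothesis hd : (1 <= d)%N.
Hypothesis c0_gt0 : 0 < c0.
Hypothesis c0_half : c0 <= 2^-1.
Hypothesis c0_smooth : d%:R + c0 * (d%:R * 2 ^+ (2 * beta)) <= r ^+ 2.
Hypothesis c0_private : c0 * (32 * expR A ^+ 2) <= 1.

(** Here [N = p + 1].  The bound [3 <= N] makes [2 N^-d <= (2 / 3)^d], so that the
    mean square of a bump exceeds the square of its mean, and the normalisation of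
    the dual functions is [1 / (d (2N)^delta)]. *)
Lemma minimax_rate_ge (p n : nat) (alpha gam : R) :
  (2 <= p)%N -> 0 < alpha -> alpha <= A -> 0 < gam ->
  gam * p.+1%:R ^+ beta <= c0 ->
  gam * Num.sqrt (n%:R * alpha ^+ 2) <= c0 * p.+1%:R ^+ d ->
  (((2 / 3) ^+ d / (4 * d%:R * 2 ^+ delta) * (gam / p.+1%:R ^+ delta))%:E <=
   minimax_rate n (sobolev_ball (d := d) beta%:R r)
                  (sobolev_ball (d := d) delta%:R 1) alpha)%E.
Proof.
move=> p2 a0 aA gam0 gsmooth gprivate.
have d0 : 0 < d%:R :> R by rewrite ltr0n.
have d1 : 1 <= d%:R :> R by rewrite ler1n.
have c02 : c0 ^+ 2 <= c0 by rewrite expr2 ler_piMr ?ltW//; have := c0_half; lra.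
set N : R := p.+1%:R in gsmooth gprivate *.
have N0 : 0 < N by rewrite ltr0n.
have N1 : 1 <= N by rewrite ler1n.
have M2N sigma : (p.*2.+1)%:R ^+ (2 * sigma) <= 2 ^+ (2 * sigma) * (N ^+ sigma) ^+ 2 :> R.
  rewrite -exprM [(sigma * 2)%N]mulnC -exprMn lerXn2r// ?nnegrE ?mulr_ge0//.
  by rewrite /N -natrM ler_nat mul2n doubleS.
pose kap : R := (d%:R * 2 ^+ delta * N ^+ delta)^-1.
have kap0 : 0 < kap by rewrite invr_gt0 !mulr_gt0 ?exprn_gt0.
apply: le_ereal_inf_tmp => _ [dZ [Z [Q [Qalpha ->]]]].
apply: le_ereal_inf_tmp => _ [ft eft <-].
have -> : (2 / 3) ^+ d / (4 * d%:R * 2 ^+ delta) * (gam / N ^+ delta) =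
    kap * gam * (2 / 3) ^+ d / 4.
  by rewrite /kap; field; rewrite !gt_eqF ?exprn_gt0.
apply: (@private_assouad _ _ p n _ _ _ _ Q alpha) => //.
- apply: le_trans c0_half; apply: le_trans gsmooth.
  by rewrite ler_peMr ?exprn_ege1// ltW.
- apply: le_trans c0_smooth; rewrite lerD2l mulrCA [leRHS]mulrCA ler_wpM2l//.
  apply: (@le_trans _ _ (gam ^+ 2 * (2 ^+ (2 * beta) * (N ^+ beta) ^+ 2))).
    by rewrite ler_wpM2l ?sqr_ge0.
  rewrite mulrCA -exprMn mulrC ler_wpM2r ?exprn_ge0//.
  apply: le_trans c02; rewrite lerXn2r ?nnegrE ?(ltW c0_gt0)//.
  by rewrite mulr_ge0 ?(ltW gam0) ?exprn_ge0 ?(ltW N0).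
- rewrite /mass; set x := n%:R * alpha ^+ 2 in gprivate.
  have x0 : 0 <= x by rewrite mulr_ge0 ?sqr_ge0.
  have Nd0 : 0 < N ^+ d by rewrite exprn_gt0.
  have h1 : (gam * (N^-1) ^+ d) ^+ 2 * x <= c0.
    apply: le_trans c02; rewrite -[x in leLHS]sqr_sqrtr// -exprMn lerXn2r ?nnegrE ?(ltW c0_gt0)//.
      by rewrite !mulr_ge0 ?exprn_ge0 ?invr_ge0 ?sqrtr_ge0 ?(ltW gam0) ?(ltW N0).
    by rewrite mulrAC exprVn ler_pdivrMr.
  have h2 : (expR alpha - 1) ^+ 2 <= (alpha * expR A) ^+ 2.
    rewrite lerXn2r ?nnegrE ?expRB1_le ?(ltW a0)//.
      by rewrite subr_ge0 ltW// expR_gt1.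
    by rewrite mulr_ge0 ?expR_ge0 ?(ltW a0).
  apply: (@le_trans _ _ (n%:R * ((alpha * expR A) ^+ 2 * (4 * gam * (N^-1) ^+ d) ^+ 2))).
    by rewrite exprMn ler_wpM2l// ler_wpM2r ?sqr_ge0.
  have -> : n%:R * ((alpha * expR A) ^+ 2 * (4 * gam * (N^-1) ^+ d) ^+ 2) =
     (16 * expR A ^+ 2) * ((gam * (N^-1) ^+ d) ^+ 2 * x) by rewrite /x; ring.
  apply: (@le_trans _ _ ((16 * expR A ^+ 2) * c0)).
    by rewrite ler_wpM2l// mulr_ge0// sqr_ge0.
  by have := c0_private; lra.
- rewrite /mass; have -> : (2 / 3) ^+ d = 2 ^+ d * 3^-1 ^+ d :> R by rewrite exprMn.
  apply: ler_pM; rewrite ?exprn_ge0 ?invr_ge0 ?(ltW N0)//.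
  + by rewrite -[leLHS]expr1 ler_eXn2l ?ltr1n.
  + by rewrite lerXn2r ?nnegrE ?invr_ge0 ?(ltW N0)// lef_pV2 ?posrE// ler_nat.
- apply: (@le_trans _ _ (kap ^+ 2 * (d%:R * (2 ^+ (2 * delta) * (N ^+ delta) ^+ 2)))).
    by rewrite ler_wpM2l ?sqr_ge0// ler_wpM2l.
  have -> : kap ^+ 2 * (d%:R * (2 ^+ (2 * delta) * (N ^+ delta) ^+ 2)) = d%:R^-1 :> R.
    rewrite [(2 * delta)%N]mulnC exprM /kap.
    by field; rewrite !gt_eqF ?exprn_gt0.
  by rewrite invf_le1.
Qed.

End rates.

Theorem theorem2p1 (R : realType) (d beta delta : nat) (A r : R)
    (hd : (1 <= d)%N) (hA : 0 < A) (hbeta : (1 <= beta)%N)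
    (hdelta : (1 <= delta)%N) (hr : 0 < r) (hrd : d%:R < r ^+ 2) :
  exists c : R, 0 < c /\
    forall (n : nat) (alpha : R),
      (1 <= n)%N -> 0 < alpha -> alpha <= A -> 1 <= n%:R * alpha ^+ 2 ->
      ((c * Num.max
          ((n%:R * alpha ^+ 2)
             `^ (- ((beta + delta)%:R / (2 * beta + 2 * d)%:R)))
          ((n%:R * alpha ^+ 2) `^ (- (1 / 2))))%:E
       <= minimax_rate n (sobolev_ball (d := d) beta%:R r)
            (sobolev_ball (d := d) delta%:R 1) alpha)%E.
Proof.
have d0 : 0 < d%:R :> R by rewrite ltr0n.
pose w : R := d%:R * 2 ^+ (2 * beta).
have w0 : 0 < w by rewrite mulr_gt0 ?exprn_gt0.
have E0 : 0 < 32 * expR A ^+ 2 by rewrite mulr_gt0 ?exprn_gt0 ?expR_gt0.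
(* The three bounds make the densities nonnegative, keep them in the Sobolev ball,
   and keep the transcripts indistinguishable. *)
pose c0 : R := Num.min (Num.min 2^-1 ((r ^+ 2 - d%:R) / w)) (32 * expR A ^+ 2)^-1.
have c0_gt0 : 0 < c0 by rewrite !lt_min !invr_gt0 ltr0n E0 divr_gt0 ?subr_gt0.
have c0_half : c0 <= 2^-1 by rewrite !ge_min lexx.
have c0_smooth : d%:R + c0 * w <= r ^+ 2.
  by rewrite addrC -lerBrDr -ler_pdivlMr// !ge_min lexx orbT.
have c0_private : c0 * (32 * expR A ^+ 2) <= 1.
  by rewrite -ler_pdivlMr// div1r !ge_min lexx orbT.
pose K : R := (2 / 3) ^+ d / (4 * d%:R * 2 ^+ delta).
have K0 : 0 < K by rewrite !(divr_gt0, mulr_gt0, exprn_gt0).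
exists (K * c0 / 4 ^+ (beta + delta)); split.
  by rewrite !(divr_gt0, mulr_gt0, exprn_gt0).
move=> n alpha n1 a0 aA; set x := n%:R * alpha ^+ 2 => x1.
have x0 : 0 < x by exact: lt_le_trans x1.
have sx1 : 1 <= Num.sqrt x by rewrite -sqrtr1 ler_wsqrtr.
have sx0 : 0 < Num.sqrt x by exact: lt_le_trans sx1.
have bound (p : nat) gam v : (2 <= p)%N -> 0 < gam ->
    gam * p.+1%:R ^+ beta <= c0 -> gam * Num.sqrt x <= c0 * p.+1%:R ^+ d ->
    c0 / 4 ^+ (beta + delta) * v <= gam / p.+1%:R ^+ delta ->
    ((K * c0 / 4 ^+ (beta + delta) * v)%:E <=
     minimax_rate n (sobolev_ball (d := d) beta%:R r)
            (sobolev_ball (d := d) delta%:R 1) alpha)%E.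
  move=> p2 gam0 g1 g2 gv.
  apply: (le_trans _ (minimax_rate_ge delta hd c0_gt0 c0_half c0_smooth
    c0_private p2 a0 aA gam0 g1 g2)).
  by rewrite lee_fin -/K -!(mulrA K) ler_wpM2l ?(ltW K0).
rewrite maxEle; case: ifP => _.
(* The parametric rate, with the smallest admissible grid. *)
- have gE : c0 / 3 ^+ beta / Num.sqrt x * Num.sqrt x = c0 / 3 ^+ beta.
    by rewrite mulfVK ?gt_eqF.
  apply: (@bound 2 (c0 / 3 ^+ beta / Num.sqrt x)) => //.
  + by rewrite !divr_gt0 ?exprn_gt0.
  + rewrite mulrAC mulfVK ?gt_eqF ?exprn_gt0// ler_pdivrMr// ler_peMr//.
    exact: ltW.
  + rewrite gE ler_pdivrMr ?exprn_gt0// -mulrA ler_peMr ?(ltW c0_gt0)//.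
    by rewrite -exprD exprn_ege1// ler1n.
  + rewrite powRN div1r powR12_sqrt ?(ltW x0)//.
    rewrite [leRHS]mulrAC ler_wpM2r ?invr_ge0 ?(ltW sx0)//.
    rewrite -[leRHS]mulrA ler_wpM2l ?(ltW c0_gt0)// -invfM -exprD.
    by rewrite lef_pV2 ?posrE ?exprn_gt0// lerXn2r ?nnegrE// ler_nat.
(* The nonparametric rate, where the two constraints on [gam] balance. *)
- pose y := x `^ ((2 * beta + 2 * d)%:R)^-1.
  have D0 : (2 * beta + 2 * d)%:R != 0 :> R by rewrite pnatr_eq0 addn_eq0 !muln_eq0 (gtn_eqF hbeta).
  have y1 : 1 <= y.
    rewrite -(powRr0 x) /y ler_powR//.
  have y0 : 0 < y by exact: lt_le_trans y1.
  have yX m : y ^+ m = x `^ (m%:R / (2 * beta + 2 * d)%:R).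
    by rewrite -powR_mulrn ?(ltW y0)// /y -powRrM mulrC.
  have ysqrt : Num.sqrt x = y ^+ (beta + d).
    rewrite yX -powR12_sqrt ?(ltW x0)//; congr (_ `^ _).
    rewrite -mulnDr natrM invfM mulrCA mulfV ?mulr1//.
    by rewrite pnatr_eq0 addn_eq0 (gtn_eqF hbeta).
  have /andP[t1 t2] := truncn_itv (ltW y0).
  (* The grid has [p.+1] points per side, at least three and at most [4 * y]. *)
  pose p := (Num.truncn y).+2.
  have yN : y <= p.+1%:R by rewrite (le_trans (ltW t2))// ler_nat /p leqW.
  have N4y : p.+1%:R <= 4 * y.
    by rewrite /p -addn3 natrD; lra.
  have N0 : 0 < p.+1%:R :> R by rewrite ltr0n.
  apply: (@bound p (c0 / p.+1%:R ^+ beta)) => //.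
  + by rewrite divr_gt0 ?exprn_gt0.
  + by rewrite mulfVK ?gt_eqF ?exprn_gt0.
  + rewrite mulrAC ler_pdivrMr ?exprn_gt0// -mulrA ler_wpM2l ?(ltW c0_gt0)//.
    by rewrite ysqrt -exprD addnC lerXn2r ?nnegrE ?(ltW y0) ?(ltW N0).
  + rewrite powRN -yX -mulrA -[leRHS]mulrA ler_wpM2l ?(ltW c0_gt0)//.
    rewrite -!invfM -exprD -exprMn lef_pV2 ?posrE ?exprn_gt0 ?mulr_gt0//.
    by rewrite lerXn2r ?nnegrE ?(ltW N0) ?mulr_ge0 ?(ltW y0).
Qed.
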